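(* For any $\epsilon>0$, if $\mu^*_{il} > \lambda_l(1-p_l)$ and $\mu^*_{el} > x_l^*$ for all $l \in \mathcal{L}$, then $$\limsup_{K \rightarrow \infty} E \left[ \sum_{l \in \mathcal{L}} \big(U_l(x_l^* ) + w_l \mu^*_{il}\big) - \sum_{l \in \mathcal{L}} \frac{1}{K} \sum_{k=1}^K U_l(\tilde{x}_l^*(k)) - \sum_{l \in \mathcal{L}} \frac{1}{K} \sum_{k=1}^K w_l I_{il}^*(a_i(k),c(k),d(k),q(k)) \right] \leq B \epsilon$$ for some $B>0$, where $(x^*,\mu_i^* )$ (together with the corresponding $\mu_e^*$) is the solution to the static problem (P), $\tilde{x}^*(k)$ is the solution to the congestion control problem (CC) with parameter $\epsilon$, and $I_i^*(a_i(k),c(k),d(k),q(k))$ is obtained from the solution to the scheduling problem (SCH) with parameter $\epsilon$.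
   Context: Network. $\mathcal{L}$ is the finite set of links, with given interference constraints specifying which links may transmit simultaneously. Time is slotted and $T$ consecutive slots form a frame. In each frame $k$, $a_i(k)=(a_{il}(k))_{l\in\mathcal{L}}$ is the vector of numbers of inelastic packet arrivals, with $a_{il}(k)$ of mean $\lambda_l$ and variance $\sigma_{il}^2$, $\Pr(a_{il}=0)>0$, $\Pr(a_{il}=1)>0$; $c(k)=(c_l(k))_{l\in\mathcal{L}}$ is the channel state, $c_l(k)\ge 0$ being the number of packets link $l$ can transmit per slot in the frame, with mean $\bar c_l$ and variance $\sigma_{cl}^2$. Both are independent across frames with the same distribution in every frame, and channels are independent of arrivals. $\Pr(a_i)$, $\Pr(c)$ denote their distributions. The channel state is constant during a frame and known at its beginning. Inelastic packets not served in their frame are discarded; $p_l$ is the maximal allowed loss probability at link $l$. $U_l$ is a concave utility function of the mean elastic arrival rate $x_l$ per frame, and $w\in\mathbb{R}_+^{|\mathcal{L}|}$ is a given weight vector. Schedules. $\mathcal{S}(a_i,c)$ is the set of feasible schedules $s=(s_{il,t},s_{el,t})_{l\in\mathcal{L},1\le t\le T}$, where $s_{il,t},s_{el,t}$ are the numbers of inelastic and elastic packets scheduled on link $l$ in slot $t$, such that in each slot any two links with $s_{il,t}+s_{el,t}>0$ do not interfere, $\sum_{t=1}^T s_{il,t}\le a_{il}$ for all $l$, and $s_{il,t}+s_{el,t}\le c_l$ for all $l,t$. Static problem (P). Maximize $\sum_{l}(U_l(x_l)+w_l\mu_{il})$ over $\mu_i(a_i,c),\mu_e(a_i,c),\mu_i,\mu_e,x,\Pr(s|a_i,c)$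 subject to, for all $l\in\mathcal{L}$ and all $a_i,c$: $\mu_{il}(a_i,c)\le\sum_{s\in\mathcal{S}(a_i,c)}\sum_{t=1}^T s_{il,t}\Pr(s|a_i,c)$; $\mu_{el}(a_i,c)\le\sum_{s\in\mathcal{S}(a_i,c)}\sum_{t=1}^T s_{el,t}\Pr(s|a_i,c)$; $\mu_{il}=\sum_{a_i}\sum_c\mu_{il}(a_i,c)\Pr(c)\Pr(a_i)$; $\mu_{el}=\sum_{a_i}\sum_c\mu_{el}(a_i,c)\Pr(c)\Pr(a_i)$; $\mu_{il}\ge\lambda_l(1-p_l)$; $0\le x_l\le\mu_{el}$; $\Pr(s|a_i,c)\ge0$ for all $s\in\mathcal{S}(a_i,c)$; $\sum_{s}\Pr(s|a_i,c)\le1$. Problem (P) is assumed to be feasible and to have a solution; starred quantities $x^*,\mu_i^*,\mu_e^*$ denote the components of a solution. Online algorithm with parameter $\epsilon>0$ and fixed $X_{max}>\max_l x_l^*$. The state in frame $k$ is $(d(k),q(k))$, with $d_l(k),q_l(k)\ge0$ (deficit counters and elastic queue lengths). Congestion control (CC): $\tilde x_l^*(k)\in\arg\max_{0\le x_l\le X_{max}}\frac1\epsilon U_l(x_l)-q_l(k)x_l$. Scheduling (SCH): $\tilde s^*(a_i(k),c(k),d(k),q(k))\in\arg\max_{s\in\mathcal{S}(a_i(k),c(k))}\sum_{l}\{[\frac1\epsilon w_l+d_l(k)]\sum_{t=1}^T s_{il,t}+q_l(k)\sum_{t=1}^T s_{el,t}\}$. Put $I_{il}^*=\sum_{t=1}^T\tilde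 s^*_{il,t}$ and $I_{el}^*=\sum_{t=1}^T\tilde s^*_{el,t}$ (functions of $(a_i(k),c(k),d(k),q(k))$). Updates: $d_l(k+1)=[d_l(k)+\tilde a_{il}(k)-I_{il}^*]^+$, $q_l(k+1)=[q_l(k)+\tilde a_{el}(k)-I_{el}^*]^+$, where $\alpha^+=\max\{\alpha,0\}$; $\tilde a_{il}(k)$ is binomial with parameters $a_{il}(k)$ and $1-p_l$ (one coin toss for each inelastic arrival); $\tilde a_{el}(k)$, the number of elastic packets admitted at link $l$, is a nonnegative-integer random variable with mean $\tilde x_l^*(k)$ (given the state) and variance at most a fixed constant $\sigma_e^2$, with $\Pr(\tilde a_{el}(k)=0)>0$ and $\Pr(\tilde a_{el}(k)=1)>0$. Then $(d(k),q(k))$ is an irreducible and aperiodic Markov chain. *)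

(* Defs.v *)
From HB Require Import structures.
From mathcomp Require Import all_boot all_order all_algebra.
From mathcomp Require Import all_classical all_reals all_analysis.
Import Order.TTheory GRing.Theory Num.Theory.
Import numFieldNormedType.Exports.

Set Implicit Arguments.
Unset Strict Implicit.
Unset Printing Implicit Defensive.

Local Open Scope classical_set_scope.
Local Open Scope ring_scope.

(* Unordered summation of a signed family: absolute summability is part of
   the definition. *)
Definition sums_to (R : realType) (I : choiceType) (f : I -> R) (s : R) :=
  summable setT (EFin \o f) /\
  (\esum_(i in setT) ((EFin \o f)^\+ i) - \esum_(i in setT) ((EFin \o f)^\- i)
   = s%:E)%E.

Definition argmax (R : realType) (X : Type) (S : set X) (f : X -> R) : set X :=
  [set x | S x /\ forall y, S y -> f y <= f x].

Definition concave_on_nonneg (R : realType) (f : R -> R) :=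
  convex_function ([set x : R | 0 <= x] : set (convex_lmodType R^o))
                  (fun x : convex_lmodType R^o => - f x).

(* Packet counts, one per link. *)
Notation counts L := {ffun L -> nat}.

(* [arr_law] and [chan_law] are the probability mass functions of the arrival
   vector and of the channel vector of one frame; the links of one vector may
   be correlated. *)
Record network (R : realType) (L : finType) := Network {
  slots : nat;
  interferes : rel L;
  arr_law : counts L -> R;
  arr_mean : L -> R;
  arr_var : L -> R;
  chan_law : counts L -> R;
  chan_mean : L -> R;
  chan_var : L -> R;
  loss : L -> R;
  utility : L -> R -> R;
  weight : L -> R }.

Record is_law (R : realType) (L : finType)
    (p : counts L -> R) (mean var : L -> R) : Prop := IsLaw {
  law_ge0 : forall v, 0 <= p v;
  law_sum1 : sums_to p 1;
  law_mean : forall l, sums_to (fun v : counts L => (v l)%:R * p v) (mean l);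
  law_var : forall l,
    sums_to (fun v : counts L => ((v l)%:R - mean l) ^+ 2 * p v) (var l) }.

Record network_ok (R : realType) (L : finType) (N : network R L) : Prop :=
    NetworkOk {
  slots_gt0 : (0 < slots N)%N;
  interferes_sym : symmetric (interferes N);
  arr_lawP : is_law (arr_law N) (arr_mean N) (arr_var N);
  arr_zero : forall l,
    (0 < \esum_(a in [set a : counts L | a l = 0%N]) (arr_law N a)%:E)%E;
  arr_one : forall l,
    (0 < \esum_(a in [set a : counts L | a l = 1%N]) (arr_law N a)%:E)%E;
  chan_lawP : is_law (chan_law N) (chan_mean N) (chan_var N);
  loss01 : forall l, 0 <= loss N l <= 1;
  utility_concave : forall l, concave_on_nonneg (utility N l);
  weight_ge0 : forall l, 0 <= weight N l }.

(* The first component gives the inelastic packets, the second one the elastic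
   packets, scheduled on each link in each slot of a frame. *)
Definition schedule (L : finType) (T : nat) : Type :=
  ({ffun L * 'I_T -> nat} * {ffun L * 'I_T -> nat})%type.

Definition inel_total (L : finType) (T : nat) (s : schedule L T) (l : L) : nat :=
  (\sum_(t < T) s.1 (l, t))%N.

Definition el_total (L : finType) (T : nat) (s : schedule L T) (l : L) : nat :=
  (\sum_(t < T) s.2 (l, t))%N.

Definition active (L : finType) (T : nat) (s : schedule L T) (l : L) (t : 'I_T) :=
  (0 < s.1 (l, t) + s.2 (l, t))%N.

Definition feasible (R : realType) (L : finType) (N : network R L)
    (a c : counts L) : set (schedule L (slots N)) :=
  [set s | [/\ forall t l l', l != l' -> active s l t -> active s l' t ->
                 ~~ interferes N l l',
               forall l, (inel_total s l <= a l)%N &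
               forall l t, (s.1 (l, t) + s.2 (l, t) <= c l)%N]].

(* So the finitely supported sums over [feasible] below are never truncated to 0. *)
Lemma finite_feasible (R : realType) (L : finType) (N : network R L)
  (a c : counts L) : finite_set (@feasible R L N a c).
Proof.
pose M := (\max_(l : L) c l)%N.
pose F := {ffun L * 'I_(slots N) -> 'I_M.+1}.
pose g (u : F * F) : schedule L (slots N) :=
  ([ffun x => nat_of_ord (u.1 x)], [ffun x => nat_of_ord (u.2 x)]).
apply: (@sub_finite_set _ _ (g @` setT)); last first.
  by apply: finite_image; exact: finite_finset.
move=> [s1 s2] [_ _ /= h].
have h' x : (s1 x + s2 x <= M)%N.
  by case: x => l t; apply: leq_trans (h l t) _; exact: leq_bigmax.
exists ([ffun x => inord (s1 x)], [ffun x => inord (s2 x)]) => //.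
rewrite /g /=; congr pair; apply/ffunP => x; rewrite !ffunE inordK // ltnS.
  exact: leq_trans (leq_addr _ _) (h' x).
exact: leq_trans (leq_addl _ _) (h' x).
Qed.

(* The variables of the static problem; [mix a c s] is Pr(s | a, c). *)
Record static_point (R : realType) (L : finType) (N : network R L) :=
    StaticPoint {
  mui_cond : counts L -> counts L -> L -> R;
  mue_cond : counts L -> counts L -> L -> R;
  mui : L -> R;
  mue : L -> R;
  rate : L -> R;
  mix : counts L -> counts L -> schedule L (slots N) -> R }.

Record static_feasible (R : realType) (L : finType) (N : network R L)
    (v : static_point N) : Prop := StaticFeasible {
  sf_mui_cond : forall l a c,
    mui_cond v a c l <=
      \sum_(s \in @feasible R L N a c) (inel_total s l)%:R * mix v a c s;
  sf_mue_cond : forall l a c,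
    mue_cond v a c l <=
      \sum_(s \in @feasible R L N a c) (el_total s l)%:R * mix v a c s;
  sf_mui : forall l,
    sums_to (fun ac : counts L * counts L =>
      mui_cond v ac.1 ac.2 l * chan_law N ac.2 * arr_law N ac.1) (mui v l);
  sf_mue : forall l,
    sums_to (fun ac : counts L * counts L =>
      mue_cond v ac.1 ac.2 l * chan_law N ac.2 * arr_law N ac.1) (mue v l);
  sf_loss : forall l, arr_mean N l * (1 - loss N l) <= mui v l;
  sf_rate : forall l, 0 <= rate v l <= mue v l;
  sf_mix_ge0 : forall a c s, feasible a c s -> 0 <= mix v a c s;
  sf_mix_le1 : forall a c, \sum_(s \in @feasible R L N a c) mix v a c s <= 1 }.

Definition static_objective (R : realType) (L : finType) (N : network R L)
    (v : static_point N) : R :=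
  \sum_(l : L) (utility N l (rate v l) + weight N l * mui v l).

Definition static_solution (R : realType) (L : finType) (N : network R L)
    (v : static_point N) : Prop :=
  argmax [set u | @static_feasible R L N u] (@static_objective R L N) v.

Definition cc_objective (R : realType) (L : finType) (N : network R L)
    (eps : R) (q : counts L) (l : L) (x : R) : R :=
  eps^-1 * utility N l x - (q l)%:R * x.

Definition sch_objective (R : realType) (L : finType) (N : network R L)
    (eps : R) (d q : counts L) (s : schedule L (slots N)) : R :=
  \sum_(l : L) ((eps^-1 * weight N l + (d l)%:R) * (inel_total s l)%:R
                + (q l)%:R * (el_total s l)%:R).

(* What is drawn in a frame: arrivals, channel, inelastic arrivals retained by
   the coin tosses, admitted elastic packets. *)
Notation draw L := (counts L * counts L * counts L * counts L)%type.

(* [sch] takes the arrivals, the channel, the deficits and the queues, in this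
   order; [draw_kernel d q] is the mass function of the draw of a frame that starts
   in state (d, q). *)
Record algorithm (R : realType) (L : finType) (N : network R L) := Algorithm {
  cc : counts L -> counts L -> L -> R;
  sch : counts L -> counts L -> counts L -> counts L -> schedule L (slots N);
  draw_kernel : counts L -> counts L -> draw L -> R }.

(* [kernel_marginal]: given the state, arrivals and channel are independent with
   their stationary laws, and the coins are tossed independently, one for each
   arrival. The dependence of the elastic admissions on the rest of the draw is
   left free. *)
Record algorithm_ok (R : realType) (L : finType) (N : network R L)
    (eps Xmax sigmae : R) (alg : algorithm N) : Prop := AlgorithmOk {
  cc_opt : forall d q l,
    argmax [set x | 0 <= x <= Xmax] (cc_objective N eps q l) (cc alg d q l);
  sch_opt : forall a c d q,
    argmax (@feasible R L N a c) (@sch_objective R L N eps d q)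
      (sch alg a c d q);
  kernel_ge0 : forall d q z, 0 <= draw_kernel alg d q z;
  kernel_marginal : forall d q a c b,
    (\esum_(e in setT) (draw_kernel alg d q (a, c, b, e))%:E =
     (arr_law N a * chan_law N c *
      \prod_(l : L) binomial_pmf (a l) (1 - loss N l) (b l))%:E)%E;
  kernel_adm_mean : forall d q l,
    sums_to (fun z : draw L => (z.2 l)%:R * draw_kernel alg d q z) (cc alg d q l);
  kernel_adm_var : forall d q l,
    (\esum_(z in setT)
       ((((z : draw L).2 l)%:R - cc alg d q l) ^+ 2 * draw_kernel alg d q z)%:E
     <= (sigmae ^+ 2)%:E)%E }.

(* Frames are numbered from 0; [deficit k] and [queue k] are the state at the
   beginning of frame k. *)
Record process (L : finType) (Om : Type) := Process {
  deficit : nat -> Om -> counts L;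
  queue : nat -> Om -> counts L;
  arr : nat -> Om -> counts L;
  chan : nat -> Om -> counts L;
  toss : nat -> Om -> counts L;
  adm : nat -> Om -> counts L }.

Definition frame_draw (L : finType) (Om : Type) (X : process L Om) (k : nat)
    (o : Om) : draw L :=
  (arr X k o, chan X k o, toss X k o, adm X k o).

(* The atom, containing the outcome [o0], of the information available at the
   beginning of frame k. *)
Definition past (L : finType) (Om : Type) (X : process L Om) (k : nat)
    (o0 : Om) : set Om :=
  [set o | [/\ deficit X 0 o = deficit X 0 o0, queue X 0 o = queue X 0 o0 &
    forall j, (j < k)%N -> frame_draw X j o = frame_draw X j o0]].

Definition chosen (R : realType) (L : finType) (N : network R L)
    (alg : algorithm N) (Om : Type) (X : process L Om) (k : nat) (o : Om) :
    schedule L (slots N) :=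
  sch alg (arr X k o) (chan X k o) (deficit X k o) (queue X k o).

(* The subtractions in the updates are truncated, i.e. they are the positive
   parts. All variables take countably many values, so measurability is that
   of their level sets. [draw_law] says that, given the past, the draw of frame
   k follows [draw_kernel] at the current state; in particular the pairs (arrivals,
   channel) are independent and identically distributed over the frames. *)
Record process_ok (R : realType) (L : finType) (N : network R L)
    (alg : algorithm N) (d : measure_display) (Om : measurableType d)
    (P : probability Om R) (X : process L Om) : Prop := ProcessOk {
  deficit_meas : forall k v, measurable [set o | deficit X k o = v];
  queue_meas : forall k v, measurable [set o | queue X k o = v];
  draw_meas : forall k z, measurable [set o | frame_draw X k o = z];
  deficit_next : forall k o l, deficit X k.+1 o l =
    (deficit X k o l + toss X k o l - inel_total (chosen alg X k o) l)%N;
  queue_next : forall k o l, queue X k.+1 o l =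
    (queue X k o l + adm X k o l - el_total (chosen alg X k o) l)%N;
  draw_law : forall k o0 z,
    (P (past X k o0 `&` [set o | frame_draw X k o = z]) =
     P (past X k o0) * (draw_kernel alg (deficit X k o0) (queue X k o0) z)%:E)%E;
  adm_zero : forall k l, (0 < P [set o | adm X k o l = 0%N])%E;
  adm_one : forall k l, (0 < P [set o | adm X k o l = 1%N])%E }.

(* Main.v *)
Require Import Defs.
From HB Require Import structures.
From mathcomp Require Import finmap.
From mathcomp Require Import all_boot all_order all_algebra.
From mathcomp Require Import all_classical all_reals all_analysis.
From mathcomp Require Import unstable measurable_realfun.
From mathcomp Require Import ring lra.
Import Order.TTheory GRing.Theory Num.Theory.
Import numFieldNormedType.Exports.

(* Lyapunov drift. Let V be the sum of the squares of all deficits and queues.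
   In each frame the expected change of V, given the state, is at most
   C + (2/eps) (reward of the frame - optimum of (P)): the cross terms of the
   squares are compared with the static solution through the optimality of (CC)
   and (SCH), what is left of them being nonpositive by the constraints of (P),
   and C bounds the second moments of all packet counts. Telescoping bounds the
   average regret by eps C / 2 + eps V(0) / (2 K); no stationarity is needed.
   As E V(0) may be infinite, this is done on the event V(0) <= M only; off that
   event the regret is bounded because the utilities are, and M is chosen such
   that the complement is improbable. *)

(** The constant B has to be fixed before [eps], the algorithm and the probability space. This is
    possible because C involves only the number of slots, the second moments of arrivals and
    channel, [Xmax] and [sigmae]; the threshold M may depend on everything else, since it enters
    through M / K. The main obstacle is integrability. A priori no product of a counter with a
    packet count is known to have a mean, and the conditional rates of (P) are bounded from above
    only. Hence the law of state and draw is first exploited for nonnegative functions, with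
    extended real values; the conditional rates are split into positive and negative parts; and in
    the pathwise drift inequality each term stands on the side where it is nonnegative. The
    right-hand side then dominates V(k+1), so that the existence of its mean propagates from frame
    to frame. The event V(0) <= M depends on the initial state alone, hence is a union of atoms of
    [past]: restricting to it leaves the conditional law of the draws unchanged. *)

Set Implicit Arguments.
Unset Strict Implicit.
Unset Printing Implicit Defensive.

Local Open Scope classical_set_scope.
Local Open Scope ring_scope.

(** * Countably valued random variables *)

Section countable_valued.
Context (d : measure_display) (Om : measurableType d) (R : realType).
Context (T : countType) (g : Om -> T).
Hypothesis mg : forall t, measurable [set o | g o = t].

Lemma measurable_countable_comp (d' : measure_display) (Y : measurableType d')
    (D : set Om) (f : T -> Y) : measurable_fun D (f \o g).
Proof.
move=> mD B mB; apply: measurableI => //.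
rewrite (_ : _ @^-1` _ =
  \bigcup_t (if asbool (B (f t)) then [set o | g o = t] else set0)).
  apply: countable_bigcupT_measurable; first exact: countableP.
  by move=> t; case: ifP.
apply/seteqP; split => [ o /= Bo|o [t _]].
  by exists (g o) => //; rewrite ifT//; apply/asboolP.
by case: ifP => // /asboolP Bt /= ->.
Qed.

Lemma measurable_countable_preimage (B : set T) : measurable [set o | B (g o)].
Proof.
have /(_ measurableT [set true]) :=
  @measurable_countable_comp _ bool setT (fun t => `[< B t >]).
rewrite setTI; rewrite (_ : _ @^-1` _ = [set o | B (g o)]).
  by apply.
by apply/seteqP; split => o /= /asboolP.
Qed.

Lemma integral_level_sets (mu : {measure set Om -> \bar R}) (A : set Om)
    (F : Om -> \bar R) : measurable A ->
  (forall o, A o -> (0 <= F o)%E) -> measurable_fun A F ->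
  (\int[mu]_(o in A) F o =
   \esum_(t in setT) \int[mu]_(o in A `&` [set o | g o = t]) F o)%E.
Proof.
move=> mA F0 mF.
(* Countable additivity of the integral is stated for sequences of sets, so the level sets are
   indexed by their codes; a number that is no code gives the empty set. *)
pose B n := [set o | A o /\ pickle (g o) = n].
have BE t : B (pickle t) = A `&` [set o | g o = t].
  apply/seteqP; split => o [Ao /=]; first by move=> /(pcan_inj pickleK) gt.
  by move=> gt; split => //; rewrite gt.
have B0 n : ~ range (@pickle T) n -> B n = set0.
  move=> h; rewrite -subset0 => o [_ gn]; apply: h; exists (g o) => //.
have mB n : measurable (B n).
  have [[t _ <-]|/B0 -> //] := pselect (range (@pickle T) n).
  by rewrite BE; exact: measurableI.
have AE : A = \bigcup_n B n.
  apply/seteqP; split => [ o Ao|o [n _ []//]].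
  by exists (pickle (g o)).
have tB : trivIset setT B.
  by move=> i j _ _ [ o [[_ <-] [_ <-]]].
rewrite {1}AE ge0_integral_bigcup//; last 2 first.
- by rewrite -AE.
- by move=> o; rewrite -AE => /F0.
rewrite nneseries_esumT; last by move=> n; apply: integral_ge0 => o [/F0].
transitivity (\esum_(n in range (@pickle T)) \int[mu]_(o in B n) F o)%E.
  rewrite [RHS]esum_mkcond; apply: eq_esum => n _.
  by case: ifPn => //; rewrite notin_setE => /B0 ->; rewrite integral_set0.
rewrite esum_image; last by move=> x y _ _; exact: (pcan_inj pickleK).
by apply: eq_esum => t _; rewrite BE.
Qed.

Lemma measure_level_sets (mu : {measure set Om -> \bar R}) (A : set Om) :
  measurable A ->
  (mu A = \esum_(t in setT) mu (A `&` [set o | g o = t]))%E.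
Proof.
move=> mA; have := @integral_level_sets mu A (cst 1%E) mA (fun _ _ => lee01).
rewrite integral_cst// mul1e => ->; last exact: measurable_cst.
by apply: eq_esum => t _; rewrite integral_cst ?mul1e//; exact: measurableI.
Qed.

End countable_valued.

Lemma ge0_esumZl (R : realType) (T : choiceType) (D : set T) (x : R)
    (a : T -> \bar R) : 0 <= x -> (forall i, (0 <= a i)%E) ->
  (\esum_(i in D) (x%:E * a i) = x%:E * \esum_(i in D) a i)%E.
Proof.
rewrite le_eqVlt => /predU1P[<-|x0] a0.
  by rewrite mul0e esum1// => i _; rewrite mul0e.
(* Only this inequality goes through finite partial sums. The converse is the same inequality for
   the factor [x^-1] and the family [x * a]. *)
have le y (b : T -> \bar R) : 0 <= y -> (forall i, (0 <= b i)%E) ->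
    (\esum_(i in D) (y%:E * b i) <= y%:E * \esum_(i in D) b i)%E.
  move=> y0 b0; apply: ge_ereal_sup => _ [X XD <-].
  by rewrite -ge0_mule_fsumr// lee_wpmul2l// ereal_sup_ubound//; exists X.
apply/eqP; rewrite eq_le le//=; last exact: ltW.
rewrite -lee_pdivlMl//; last first.
have -> : (\esum_(i in D) a i = \esum_(i in D) (x^-1%:E * (x%:E * a i)))%E.
  by apply: eq_esum => i _; rewrite muleA -EFinM mulVf ?gt_eqF// mul1e.
apply: le; first by rewrite invr_ge0 ltW.
by move=> i; rewrite mule_ge0// lee_fin ltW.
Qed.

(** * Law of a state and of the following draw *)

Section process_law.
Context (R : realType) (L : finType) (N : network R L) (alg : algorithm N).
Context (d : measure_display) (Om : measurableType d) (P : probability Om R).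
Context (X : process L Om) (HX : process_ok alg P X).

Definition state k w : counts L * counts L := (deficit X k w, queue X k w).

Let measurable_state k s : measurable [set w | state k w = s].
Proof.
rewrite (_ : [set w | _] =
  [set w | deficit X k w = s.1] `&` [set w | queue X k w = s.2]).
  by apply: measurableI; [exact: (deficit_meas HX)|exact: (queue_meas HX)].
apply/seteqP; split => w /=; first by rewrite /state => <-.
by rewrite /state => -[-> ->]; rewrite -surjective_pairing.
Qed.

(** A single variable with countably many values whose level sets are the atoms [past], so that sums
    over atoms become sums over its values. *)
Definition history k w : counts L * counts L * seq (draw L) :=
  (state 0 w, [seq frame_draw X j w | j <- iota 0 k]).

Lemma history_past k w0 : [set w | history k w = history k w0] = past X k w0.
Proof.
apply/seteqP; split => w /=.
  move=> [d0 q0 /eq_in_map h]; split => // j jk.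
  by apply: h; rewrite mem_iota.
move=> [d0 q0 h]; rewrite /history /state d0 q0; congr pair.
by apply/eq_in_map => j; rewrite mem_iota add0n => /andP[_ /h].
Qed.

Let measurable_history k t : measurable [set w | history k w = t].
Proof.
have [[w0 <-]|no] := pselect (exists w, history k w = t); last first.
  rewrite (_ : [set w | _] = set0)//.
  by rewrite -subset0 => w ho; apply: no; exists w.
rewrite history_past.
rewrite (_ : past _ _ _ = [set w | state 0 w = state 0 w0] `&`
   \bigcap_(j in `I_k) [set w | frame_draw X j w = frame_draw X j w0]).
  apply: measurableI; first exact: measurable_state.
  apply: fin_bigcap_measurable; first exact: finite_II.
  by move=> j _; exact: (draw_meas HX).
apply/seteqP; split => w /=.
  by move=> [d0 q0 h]; split => //; rewrite /state d0 q0.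
by case=> -[d0 q0] h; split.
Qed.

(** The updates are deterministic functions of the state and the draw, so induction on the frame
    applies. *)
Lemma past_state k w0 w : past X k w0 w -> state k w = state k w0.
Proof.
elim: k => [|k ih]; first by case=> d0 q0 _; rewrite /state d0 q0.
case=> d0 q0 h.
have [dk qk] : state k w = state k w0.
  by apply: ih; split => // j jk; apply: h; rewrite ltnS ltnW.
have [ak ck tk ek] := h k (ltnSn k).
rewrite /state; congr pair; apply/ffunP => l.
  by rewrite !(deficit_next HX) /chosen ak ck tk dk qk.
by rewrite !(queue_next HX) /chosen ak ck ek dk qk.
Qed.

Hypothesis kernel_ge0 : forall d q z, 0 <= draw_kernel alg d q z.

Variable I : set (counts L * counts L).

Definition start_in := [set w | I (state 0 w)].

Lemma measurable_start_in : measurable start_in.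
Proof. exact: (measurable_countable_preimage (measurable_state 0)). Qed.

(** The initial state and the state of frame k are both constant on every atom of [past]. The event
    is therefore a union of atoms, on each of which the draw has the same kernel, that of [s];
    summing over the atoms gives the claim. *)
Lemma draw_law_state k s z :
  (P (start_in `&` [set w | state k w = s] `&` [set w | frame_draw X k w = z]) =
   P (start_in `&` [set w | state k w = s]) *
     (draw_kernel alg s.1 s.2 z)%:E)%E.
Proof.
set B := start_in `&` _; set K := draw_kernel _ _ _ _.
have mB : measurable B by apply: measurableI; [exact: measurable_start_in|].
have mZ : measurable [set w | frame_draw X k w = z] by exact: (draw_meas HX).
have K0 : 0 <= K by exact: kernel_ge0.
rewrite (measure_level_sets (measurable_history k) P); last exact: measurableI.
rewrite muleC (measure_level_sets (measurable_history k) P mB) -ge0_esumZl//.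
apply: eq_esum => t _; rewrite -setIA [X in _ `&` X]setIC setIA.
have [->|/set0P[w0 [[ w0I /= w0s] /= w0t]]] :=
  eqVneq (B `&` [set w | history k w = t]) set0.
  by rewrite set0I measure0 mule0.
have -> : B `&` [set w | history k w = t] = past X k w0.
  rewrite -w0t history_past; apply/seteqP; split => w; first by case.
  move=> po; split => //; split; rewrite /start_in /=.
    by case: po => d0 q0 _; rewrite /state d0 q0.
  by rewrite (past_state po).
by rewrite (draw_law HX) muleC /K -w0s.
Qed.

Notation A := start_in.

(** The tower property without conditional expectations: both sides are cut along the level sets of
    the state, the left one also along those of the draw. Both may be infinite, as nothing is known
    to be integrable at this stage. *)
Lemma integral_state_draw k (h : counts L * counts L -> R) (g : draw L -> R) :
  (forall s, 0 <= h s) -> (forall z, 0 <= g z) ->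
  (\int[P]_(w in A) (h (state k w) * g (frame_draw X k w))%:E =
   \int[P]_(w in A) ((h (state k w))%:E *
     \esum_(z in setT) (g z * draw_kernel alg (state k w).1 (state k w).2 z)%:E))%E.
Proof.
move=> h0 g0.
have mA := measurable_start_in.
have mS s : measurable (A `&` [set w | state k w = s]).
  by apply: measurableI; [exact: measurable_start_in|].
have mZ z : measurable [set w | frame_draw X k w = z] by exact: (draw_meas HX).
have mSZ (sz : (counts L * counts L) * draw L) :
    measurable [set w | (state k w, frame_draw X k w) = sz].
  rewrite (_ : [set w | _] = [set w | state k w = sz.1] `&`
     [set w | frame_draw X k w = sz.2]); first exact: measurableI.
  apply/seteqP; split => w /=; first by move=> <-.
  by move=> [-> ->]; rewrite -surjective_pairing.
have esum_ge0' s : (0 <= \esum_(z in setT) (g z * draw_kernel alg s.1 s.2 z)%:E)%E.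
  by apply: esum_ge0 => z _; rewrite lee_fin mulr_ge0.
have mhg D : measurable_fun D
    (fun w => (h (state k w) * g (frame_draw X k w))%:E).
  exact: (@measurable_countable_comp _ _ _ _ mSZ _ (\bar R) D
    (fun sz => (h sz.1 * g sz.2)%:E)).
rewrite (integral_level_sets (measurable_state k))//; last first.
  by move=> w _; rewrite lee_fin mulr_ge0.
rewrite [RHS](integral_level_sets (measurable_state k))//; last 2 first.
- by move=> w _; apply: mule_ge0 => //; rewrite lee_fin.
- exact: (@measurable_countable_comp _ _ _ _ (measurable_state k) _ (\bar R) A (fun s =>
    ((h s)%:E * \esum_(z in setT) (g z * draw_kernel alg s.1 s.2 z)%:E)%E)).
apply: eq_esum => s _.
set B := A `&` _.
have mB : measurable B by exact: mS.
set M := ((h s)%:E * (\esum_(z in setT) (g z * draw_kernel alg s.1 s.2 z)%:E))%E.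
transitivity (M * P B)%E; last first.
  rewrite [RHS](eq_integral (cst M)); first by rewrite integral_cst//; exact: mS.
  move=> w.
  by rewrite inE => -[_ sw]; rewrite (sw : state k w = s).
rewrite (integral_level_sets mZ)//; last first.
  by move=> w _; rewrite lee_fin mulr_ge0.
rewrite /M -ge0_esumZl//; last by move=> z; rewrite lee_fin mulr_ge0.
have PB : P B = (fine (P B))%:E by rewrite fineK// fin_num_measure.
rewrite muleC PB -ge0_esumZl//; last 2 first.
- by rewrite fine_ge0.
- by move=> z; apply: mule_ge0; rewrite lee_fin// mulr_ge0.
apply: eq_esum => z _.
transitivity ((h s * g z)%:E * P (B `&` [set w | frame_draw X k w = z]))%E.
  rewrite (eq_integral (cst (h s * g z)%:E)); first
    by rewrite integral_cst//; exact: measurableI.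
  move=> w; rewrite inE => -[[_ sw] zw].
  by rewrite (sw : state k w = s) (zw : frame_draw X k w = z).
by rewrite draw_law_state -/B -PB muleCA -!EFinM -mulrA.
Qed.

End process_law.

(** * Moments of a draw *)

Lemma esum_pair (R : realType) (T1 T2 : choiceType) (a : T1 * T2 -> \bar R) :
  (forall k, (0 <= a k)%E) ->
  (\esum_(k in setT) a k = \esum_(i in setT) \esum_(j in setT) a (i, j))%E.
Proof.
move=> a0; rewrite esum_esum//.
rewrite (_ : _ `*`` _ = setT); last by apply/seteqP; split.
by apply: eq_esum => -[].
Qed.

(** Because of the common bound [M] only finitely many vectors contribute, and the claim becomes the
    finite distributivity of product over sum. *)
Lemma esum_prod_ffun (R : realType) (L : finType) (M : nat)
    (g : L -> nat -> R) :
  (forall l n, 0 <= g l n) -> (forall l n, (M < n)%N -> g l n = 0) ->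
  (\esum_(b in [set: {ffun L -> nat}]) (\prod_l g l (b l))%:E =
   (\prod_l \sum_(n < M.+1) g l n)%:E)%E.
Proof.
move=> g0 gM.
pose e (f : {ffun L -> 'I_M.+1}) : {ffun L -> nat} :=
  [ffun l => nat_of_ord (f l)].
have e_inj : injective e.
  move=> f f' /ffunP ff'; apply/ffunP => l; apply: val_inj.
  by have := ff' l; rewrite !ffunE.
transitivity (\esum_(b in range e) (\prod_l g l (b l))%:E)%E.
  rewrite [RHS]esum_mkcond; apply: eq_esum => b _.
  case: ifPn => //; rewrite notin_setE => nb; congr EFin.
  have [l Ml] : exists l, (M < b l)%N.
    apply/existsP; rewrite -[X in is_true X]negbK negb_exists.
    apply/negP => /forallP h; apply: nb.
    exists [ffun l => inord (b l)] => //; apply/ffunP => l.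
    by rewrite !ffunE inordK// ltnS leqNgt h.
  by apply/eqP/prodf_eq0; exists l => //; rewrite gM.
rewrite esum_image; last by move=> x y _ _; exact: e_inj.
rewrite esum_fset; [|exact: finite_finset|]; last first.
  by move=> i _; rewrite lee_fin prodr_ge0.
rewrite (_ : setT = [set` index_enum {ffun L -> 'I_M.+1}]); last first.
  by apply/seteqP; split => f //= _; exact: mem_index_enum.
rewrite -fsbig_seq ?index_enum_uniq// sumEFin bigA_distr_bigA/=.
by congr EFin; apply: eq_bigr => f _; apply: eq_bigr => l _; rewrite ffunE.
Qed.

(** The range extends to [M] so that one range serves all links at once; beyond [n] the binomial
    coefficients vanish. *)
Lemma sum_binomial_pmf (R : realType) (M n : nat) (p : R) : (n <= M)%N ->
  \sum_(k < M.+1) binomial_pmf n p k = 1.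
Proof.
move=> nM; rewrite -(@big_mkord _ _ _ M.+1 xpredT (binomial_pmf n p)).
rewrite (@big_cat_nat _ _ _ n.+1)//= [X in _ + X]big1_seq ?addr0; last first.
  move=> k; rewrite mem_index_iota => /andP[_ /andP[nk _]].
  by rewrite /binomial_pmf bin_small.
rewrite big_mkord /binomial_pmf.
under eq_bigr do rewrite mulrC.
by rewrite -exprDn addrC add_onemK expr1n.
Qed.

Lemma sum_binomial_pmf_mean (R : realType) (M n : nat) (p : R) : (n <= M)%N ->
  \sum_(k < M.+1) k%:R * binomial_pmf n p k = n%:R * p.
Proof.
case: n => [_|n nM].
  rewrite big1 ?mul0r// => -[[|k] kM] _ /=; first by rewrite mul0r.
  by rewrite /binomial_pmf bin0n mulr0n mulr0.
case: M nM => // M; rewrite ltnS => nM.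
rewrite big_ord_recl mul0r add0r.
transitivity (\sum_(k < M.+1) n.+1%:R * p * binomial_pmf n p k).
  apply: eq_bigr => k _; rewrite /binomial_pmf lift0 subSS exprS.
  (* Absorbing the factor k+1 into the binomial coefficient leaves the mass function with one trial
     fewer, whose total mass is 1. *)
  have /(congr1 (fun j : nat => j%:R : R)) := mul_bin_diag n.+1 k.
  rewrite !natrM/= => h.
  rewrite -[(p * _ * _) *+ _]mulr_natr -[(p ^+ k * _) *+ _]mulr_natr.
  set x := p ^+ k; set y := _ ^+ (n - k).
  transitivity (p * x * y * (k.+1%:R * 'C(n.+1, k.+1)%:R)).
    by rewrite mulrCA !mulrA.
  by rewrite -h; set c := 'C(_, _)%:R; set m := n.+1%:R; ring.
by rewrite -mulr_sumr sum_binomial_pmf ?mulr1.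
Qed.

Lemma sums_to_ge0 (R : realType) (I : choiceType) (f : I -> R) (s : R) :
  (forall i, 0 <= f i) -> sums_to f s -> (\esum_(i in setT) (f i)%:E = s%:E)%E.
Proof.
move=> f0 [_ <-]; rewrite [X in (_ - X)%E]esum1 ?sube0; last first.
  by move=> i _; rewrite funenegE/= max_r// lee_fin oppr_le0.
by apply: eq_esum => i _; rewrite funeposE/= max_l// lee_fin.
Qed.

(** Meant for the conditional rates of (P), which may be negative: each part is a nonnegative family
    with finite sum, to which the rearrangements of [\esum] apply. *)
Lemma sums_to_parts (R : realType) (I : choiceType) (f p : I -> R) (s : R) :
  (forall i, 0 <= p i) -> sums_to (fun i => f i * p i) s ->
  exists x y : R, [/\ x - y = s,
    (\esum_(i in setT) (Num.max (f i) 0 * p i)%:E = x%:E)%E &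
    (\esum_(i in setT) (Num.max (- f i) 0 * p i)%:E = y%:E)%E].
Proof.
move=> p0 [sf]; set g := EFin \o _.
have -> : (\esum_(i in setT) (Num.max (f i) 0 * p i)%:E =
           \esum_(i in setT) g^\+ i)%E.
  by apply: eq_esum => i _; rewrite funeposE/= maxr_pMl// mul0r EFin_max.
have -> : (\esum_(i in setT) (Num.max (- f i) 0 * p i)%:E =
           \esum_(i in setT) g^\- i)%E.
  by apply: eq_esum => i _; rewrite funenegE/= maxr_pMl// mul0r mulNr EFin_max.
have fin h : (forall i, 0 <= h i)%E -> summable setT h ->
    exists x : R, (\esum_(i in setT) h i = x%:E)%E.
  move=> h0; rewrite summableE.
  under eq_esum do rewrite gee0_abs//.
  by move=> hfin; exists (fine (\esum_(i in setT) h i)%E); rewrite fineK.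
have [x xE] := fin _ _ (funepos_ge0 g) (summable_funepos sf).
have [y yE] := fin _ _ (funeneg_ge0 g) (summable_funeneg sf).
by rewrite xE yE => -[<-]; exists x, y.
Qed.

Lemma esum_independent (R : realType) (T1 T2 : choiceType) (u : T1 -> R)
    (v : T2 -> R) (x y : R) :
  (forall i, 0 <= u i) -> (forall j, 0 <= v j) ->
  (\esum_(i in setT) (u i)%:E = x%:E)%E ->
  (\esum_(j in setT) (v j)%:E = y%:E)%E ->
  (\esum_(k in [set: T1 * T2]) (u k.1 * v k.2)%:E = (x * y)%:E)%E.
Proof.
move=> u0 v0 ux vy; rewrite esum_pair; last by move=> k; rewrite lee_fin mulr_ge0.
have y0 : 0 <= y by rewrite -lee_fin -vy esum_ge0// => j _; rewrite lee_fin.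
rewrite mulrC EFinM -ux -ge0_esumZl//.
apply: eq_esum => i _ /=.
by rewrite muleC -vy -ge0_esumZl//.
Qed.

Lemma law_second_moment (R : realType) (L : finType) (p : counts L -> R)
    (mean var : L -> R) (l : L) : is_law p mean var ->
  exists x : R, (\esum_(v in [set: counts L]) ((v l)%:R ^+ 2 * p v)%:E = x%:E)%E.
Proof.
move=> [p0 p1 _ pv].
have sum1 := sums_to_ge0 p0 p1.
have sumv := sums_to_ge0 (fun v => mulr_ge0 (sqr_ge0 _) (p0 v)) (pv l).
set S := esum _ _.
suff : (S <= (2 * var l)%:E + (2 * mean l ^+ 2)%:E)%E.
  move=> SC; exists (fine S); rewrite fineK// ge0_fin_numE.
    by rewrite (le_lt_trans SC)// -EFinD ltry.
  by apply: esum_ge0 => v _; rewrite lee_fin mulr_ge0// sqr_ge0.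
have m0 : 0 <= 2 * mean l ^+ 2 by rewrite mulr_ge0// sqr_ge0.
rewrite -[X in (_ + X)%E]mule1 EFinM -sumv -sum1 -!ge0_esumZl//;
  try by move=> v; rewrite lee_fin mulr_ge0// sqr_ge0.
rewrite -esumD; last 2 first.
- by move=> v _; rewrite lee_fin mulr_ge0// mulr_ge0// sqr_ge0.
- by move=> v _; rewrite lee_fin mulr_ge0// mulr_ge0// sqr_ge0.
apply: le_esum => v _; rewrite -!EFinM -EFinD lee_fin.
rewrite mulrA -mulrDl ler_wpM2r//.
set a := (v l)%:R; set m := mean l.
(* The difference 2 (a - m)^2 + 2 m^2 - a^2 equals (a - 2 m)^2. *)
have := sqr_ge0 (a - 2 * m); rewrite !expr2; nra.
Qed.

Section kernel_moments.
Context (R : realType) (L : finType) (N : network R L) (HN : network_ok N).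
Context (eps Xmax sigmae : R) (alg : algorithm N).
Hypothesis Halg : algorithm_ok eps Xmax sigmae alg.
Variables d q : counts L.

Let arr_law_ge0 a : 0 <= arr_law N a.
Proof. exact: law_ge0 (arr_lawP HN) a. Qed.

Let chan_law_ge0 c : 0 <= chan_law N c.
Proof. exact: law_ge0 (chan_lawP HN) c. Qed.

Let loss_compl l : 0 <= 1 - loss N l <= 1.
Proof. by have := loss01 HN l; lra. Qed.

Let pmf_ge0 n l k : 0 <= binomial_pmf n (1 - loss N l) k.
Proof. exact: binomial_pmf_ge0. Qed.

(** The model prescribes the joint law of arrivals, channel and tosses, but not how the admissions
    depend on them. So [f] ignores the admissions, and the innermost sum is [kernel_marginal]. *)
Lemma kernel_sum_frame (f : counts L * counts L -> counts L -> R) :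
  (forall ac b, 0 <= f ac b) ->
  (\esum_(z in [set: draw L]) (f z.1.1 z.1.2 * draw_kernel alg d q z)%:E =
   \esum_(ac in [set: counts L * counts L]) ((arr_law N ac.1 * chan_law N ac.2)%:E *
     \esum_(b in [set: counts L])
       (f ac b * \prod_l binomial_pmf (ac.1 l) (1 - loss N l) (b l))%:E))%E.
Proof.
move=> f0; have k0 := kernel_ge0 Halg d q.
have pr0 (a b : counts L) : 0 <= \prod_l binomial_pmf (a l) (1 - loss N l) (b l).
  exact: prodr_ge0.
rewrite esum_pair; last by move=> z; rewrite lee_fin mulr_ge0.
rewrite esum_pair; last by move=> y; apply: esum_ge0 => e _; rewrite lee_fin mulr_ge0.
apply: eq_esum => -[a c] _ /=.
rewrite -ge0_esumZl; last 2 first.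
- by rewrite mulr_ge0.
- by move=> b; rewrite lee_fin mulr_ge0.
apply: eq_esum => b _.
under eq_esum do rewrite EFinM.
rewrite ge0_esumZl//; last by move=> e; rewrite lee_fin.
by rewrite (kernel_marginal Halg) -!EFinM mulrCA.
Qed.

Lemma kernel_sum_env (f : counts L * counts L -> R) :
  (forall ac, 0 <= f ac) ->
  (\esum_(z in [set: draw L]) (f z.1.1 * draw_kernel alg d q z)%:E =
   \esum_(ac in [set: counts L * counts L]) (f ac * (chan_law N ac.2 * arr_law N ac.1))%:E)%E.
Proof.
move=> f0; rewrite (kernel_sum_frame (f := fun ac _ => f ac))//.
apply: eq_esum => -[a c] _ /=.
under eq_esum do rewrite EFinM.
rewrite ge0_esumZl//; last by move=> b; rewrite lee_fin prodr_ge0.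
rewrite (@esum_prod_ffun _ _ (\max_l a l)
  (fun l => binomial_pmf (a l) (1 - loss N l)))//; last first.
  move=> l n aln; rewrite /binomial_pmf bin_small//.
  by rewrite (leq_ltn_trans _ aln)//; exact: leq_bigmax.
rewrite big1 ?mule1; last by move=> l _; rewrite sum_binomial_pmf//; exact: leq_bigmax.
by rewrite -EFinM mulrC [arr_law _ _ * _]mulrC.
Qed.

Lemma kernel_mean_toss l :
  (\esum_(z in [set: draw L]) ((z.1.2 l)%:R * draw_kernel alg d q z)%:E =
   (arr_mean N l * (1 - loss N l))%:E)%E.
Proof.
rewrite (kernel_sum_frame (f := fun _ b => (b l)%:R))//.
transitivity (\esum_(ac in [set: counts L * counts L])
    (((1 - loss N l) * ((ac.1 l)%:R * arr_law N ac.1)) * chan_law N ac.2)%:E)%E.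
  apply: eq_esum => -[a c] _ /=.
  (* The factor [b l] is absorbed into the factor of link [l], so that the sum over [b] still
     factorizes: link [l] yields a binomial mean, the other links yield 1. *)
  pose g l' n := (if l' == l then n%:R else 1) * binomial_pmf (a l') (1 - loss N l') n.
  have gE (b : counts L) : (b l)%:R *
      \prod_l binomial_pmf (a l) (1 - loss N l) (b l) = \prod_l' g l' (b l').
    by rewrite big_split/= -big_mkcond/= big_pred1_eq.
  under eq_esum do rewrite gE.
  rewrite (@esum_prod_ffun _ _ (\max_l a l) g)//; last 2 first.
  - by move=> l' n; rewrite mulr_ge0//; case: ifP.
  - move=> l' n aln; rewrite /g /binomial_pmf bin_small ?mulr0//.
    by rewrite (leq_ltn_trans _ aln)//; exact: leq_bigmax.
  rewrite (bigD1 l)//= [\prod_(i | _) _]big1 ?mulr1; last first.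
    move=> l' /negbTE l'l; rewrite /g l'l.
    under eq_bigr do rewrite mul1r.
    by rewrite sum_binomial_pmf//; exact: leq_bigmax.
  rewrite /g eqxx sum_binomial_pmf_mean; last exact: leq_bigmax.
  by rewrite -EFinM; congr EFin; ring.
have /andP[p0 _] := loss_compl l.
rewrite (@esum_independent _ (counts L) (counts L)
  (fun a : counts L => (1 - loss N l) * ((a l)%:R * arr_law N a))
  (chan_law N) ((1 - loss N l) * arr_mean N l) 1)//.
- by rewrite mulr1 mulrC.
- by move=> a; rewrite !mulr_ge0.
- under eq_esum do rewrite EFinM.
  rewrite ge0_esumZl//; last by move=> a; rewrite lee_fin mulr_ge0.
  rewrite (sums_to_ge0 _ (law_mean (arr_lawP HN) l)) ?EFinM// => a.
  by rewrite mulr_ge0.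
- by rewrite (sums_to_ge0 _ (law_sum1 (chan_lawP HN))).
Qed.

Lemma kernel_second_moment_arr l (x : R) :
  (\esum_(a in [set: counts L]) ((a l)%:R ^+ 2 * arr_law N a)%:E = x%:E)%E ->
  (\esum_(z in [set: draw L]) ((z.1.1.1 l)%:R ^+ 2 * draw_kernel alg d q z)%:E = x%:E)%E.
Proof.
move=> hx; rewrite (kernel_sum_env (f := fun ac => (ac.1 l)%:R ^+ 2)); last first.
  by move=> ac; rewrite sqr_ge0.
rewrite -[x]mulr1 -(esum_independent _ _ hx (sums_to_ge0 _ (law_sum1 (chan_lawP HN))))//.
- by apply: eq_esum => -[a c] _ /=; congr EFin; ring.
- by move=> a; rewrite mulr_ge0// sqr_ge0.
Qed.

Lemma kernel_second_moment_chan l (x : R) :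
  (\esum_(c in [set: counts L]) ((c l)%:R ^+ 2 * chan_law N c)%:E = x%:E)%E ->
  (\esum_(z in [set: draw L]) ((z.1.1.2 l)%:R ^+ 2 * draw_kernel alg d q z)%:E = x%:E)%E.
Proof.
move=> hx; rewrite (kernel_sum_env (f := fun ac => (ac.2 l)%:R ^+ 2)); last first.
  by move=> ac; rewrite sqr_ge0.
rewrite -[x]mul1r -(esum_independent _ _ (sums_to_ge0 _ (law_sum1 (arr_lawP HN))) hx)//.
- by apply: eq_esum => -[a c] _ /=; congr EFin; ring.
- by move=> a; rewrite mulr_ge0// sqr_ge0.
Qed.

Lemma kernel_second_moment_toss l (x : R) :
  (\esum_(a in [set: counts L]) ((a l)%:R ^+ 2 * arr_law N a)%:E = x%:E)%E ->
  (\esum_(z in [set: draw L]) ((z.1.2 l)%:R ^+ 2 * draw_kernel alg d q z)%:E <= x%:E)%E.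
Proof.
move=> hx; rewrite -(kernel_second_moment_arr hx).
rewrite (kernel_sum_frame (f := fun _ b => (b l)%:R ^+ 2)); last first.
  by move=> _ b; rewrite sqr_ge0.
rewrite (kernel_sum_frame (f := fun ac _ => (ac.1 l)%:R ^+ 2)); last first.
  by move=> ac _; rewrite sqr_ge0.
apply: le_esum => -[a c] _ /=.
rewrite lee_wpmul2l ?lee_fin ?mulr_ge0//; apply: le_esum => b _.
(* A vector with more retained packets than arrivals on link [l] has mass 0. *)
rewrite lee_fin; have [ba|ab] := leqP (b l) (a l).
  by rewrite ler_wpM2r ?prodr_ge0// ler_sqr ?nnegrE// ler_nat.
rewrite (bigD1 l)//= {1 3}/binomial_pmf bin_small// mulr0n !mul0r !mulr0.
exact: lexx.
Qed.

(** With x the mean, z^2 = (z - x)^2 + 2 x z - x^2. Dropping the last term keeps all families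
    nonnegative, at the price of the factor 2 before [Xmax ^+ 2]. *)
Lemma kernel_second_moment_adm l :
  (\esum_(z in [set: draw L]) ((z.2 l)%:R ^+ 2 * draw_kernel alg d q z)%:E
   <= (sigmae ^+ 2 + 2 * Xmax ^+ 2)%:E)%E.
Proof.
have k0 := kernel_ge0 Halg d q.
have [/andP[x0 xX] _] := cc_opt Halg d q l.
have mE := sums_to_ge0 (fun z => mulr_ge0 (ler0n _ _) (k0 z))
  (kernel_adm_mean Halg d q l).
have vE := kernel_adm_var Halg d q l.
set x := cc alg d q l in x0 xX mE vE.
apply: (@le_trans _ _ ((sigmae ^+ 2)%:E + (2 * x * x)%:E)%E); last first.
  by rewrite -EFinD lee_fin lerD2l -mulrA ler_wpM2l// expr2 ler_pM.
rewrite (EFinM (2 * x)) -mE -ge0_esumZl ?mulr_ge0//; last first.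
  by move=> z; rewrite lee_fin mulr_ge0.
apply: le_trans (leeD2r _ vE); rewrite -esumD//; last 2 first.
- by move=> z _; rewrite lee_fin mulr_ge0// sqr_ge0.
- by move=> z _; rewrite lee_fin !mulr_ge0.
apply: le_esum => z _; rewrite -EFinM -EFinD lee_fin mulrA -mulrDl ler_wpM2r//.
by have := sqr_ge0 x; rewrite !expr2; nra.
Qed.

End kernel_moments.

(** * Means over an event *)

Section has_mean.
Context (d : measure_display) (Om : measurableType d) (R : realType).
Context (P : probability Om R) (A : set Om) (mA : measurable A).
Implicit Types (F G : Om -> R) (x y c : R).

(** Integrability and value travel together, so that the mean of a long sum is assembled term by
    term. The mean is not divided by the probability of [A]: a constant c has mean c P(A). *)
Definition has_mean (F : Om -> R) (x : R) :=
  P.-integrable A (EFin \o F) /\ \int[P]_(w in A) F w = x.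

Lemma has_mean_integral F x : has_mean F x ->
  (\int[P]_(w in A) (F w)%:E = x%:E)%E.
Proof. by move=> [iF <-]; rewrite fineK//; exact: integrable_fin_num. Qed.

Lemma integral_has_mean F x : measurable_fun A F -> (forall w, A w -> 0 <= F w) ->
  (\int[P]_(w in A) (F w)%:E = x%:E)%E -> has_mean F x.
Proof.
move=> mF F0 Fx; split; last by rewrite /Rintegral Fx.
apply/integrableP; split; first exact/measurable_EFinP.
rewrite (eq_integral (EFin \o F)); first by rewrite Fx ltry.
by move=> w; rewrite inE => /F0 Fw; rewrite /= ger0_norm.
Qed.

Lemma has_mean_cst c : has_mean (cst c) (c * fine (P A)).
Proof.
split; last by rewrite Rintegral_cst.
exact: finite_measure_integrable_cst.
Qed.

Lemma has_meanD F G x y : has_mean F x -> has_mean G y ->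
  has_mean (fun w => F w + G w) (x + y).
Proof.
move=> [iF <-] [iG <-]; split; last by rewrite RintegralD.
by have := integrableD mA iF iG; apply: eq_integrable.
Qed.

Lemma has_meanZ c F x : has_mean F x -> has_mean (fun w => c * F w) (c * x).
Proof.
move=> [iF <-]; split; last by rewrite RintegralZl.
by have := integrableZl mA c iF; apply: eq_integrable.
Qed.

Lemma has_mean_sum (I : Type) (r : seq I) (F : I -> Om -> R) (x : I -> R) :
  (forall i, has_mean (F i) (x i)) ->
  has_mean (fun w => \sum_(i <- r) F i w) (\sum_(i <- r) x i).
Proof.
move=> h; elim: r => [|i r ih].
  rewrite big_nil; under eq_fun do rewrite big_nil.
  by have := has_mean_cst 0; rewrite mul0r.
by rewrite big_cons; under eq_fun do rewrite big_cons; exact: has_meanD.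
Qed.

Lemma has_mean_le F G x y : has_mean F x -> has_mean G y ->
  (forall w, A w -> F w <= G w) -> x <= y.
Proof. by move=> [iF <-] [iG <-] FG; exact: le_Rintegral. Qed.

Lemma has_mean_dominated F G y : measurable_fun A F -> has_mean G y ->
  (forall w, A w -> `|F w| <= G w) -> exists x, has_mean F x.
Proof.
move=> mF [iG _] FG; exists (\int[P]_(w in A) F w); split=> //.
apply: le_integrable iG => //; first exact/measurable_EFinP.
move=> w /FG Fw; rewrite /= lee_fin; apply: le_trans Fw _; exact: ler_norm.
Qed.

End has_mean.

Section state_draw_mean.
Context (R : realType) (L : finType) (N : network R L) (alg : algorithm N).
Context (d : measure_display) (Om : measurableType d) (P : probability Om R).
Context (X : process L Om) (HX : process_ok alg P X).
Hypothesis kernel_ge0 : forall d q z, 0 <= draw_kernel alg d q z.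
Variable I : set (counts L * counts L).

Lemma measurable_state_draw (D : set Om) k
    (F : counts L * counts L -> draw L -> R) :
  measurable_fun D (fun w => F (state X k w) (frame_draw X k w)).
Proof.
have m (z : counts L * counts L * draw L) :
    measurable [set w | (state X k w, frame_draw X k w) = z].
  rewrite (_ : [set w | _] = ([set w | deficit X k w = z.1.1] `&`
    [set w | queue X k w = z.1.2]) `&` [set w | frame_draw X k w = z.2]).
    apply: measurableI; last exact: (draw_meas HX).
    by apply: measurableI; [exact: (deficit_meas HX)|exact: (queue_meas HX)].
  apply/seteqP; split => w /=; first by move=> <-.
  by case: z => -[x y] z /= [[<- <-] <-].
exact: (@measurable_countable_comp _ _ _ _ m _ R D (fun sz => F sz.1 sz.2)).
Qed.

Notation mean := (has_mean P (start_in X I)).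

(** With [m] the conditional mean of [g], integrability of [h * g] is inherited from [h * m]: the
    two integrals agree as extended reals and the second is finite. *)
Lemma has_mean_draw k (h m : counts L * counts L -> R) (g : draw L -> R) x :
  (forall s, 0 <= h s) -> (forall z, 0 <= g z) ->
  (forall s, \esum_(z in [set: draw L]) (g z * draw_kernel alg s.1 s.2 z)%:E =
             (m s)%:E)%E ->
  mean (fun w => h (state X k w) * m (state X k w)) x ->
  mean (fun w => h (state X k w) * g (frame_draw X k w)) x.
Proof.
move=> h0 g0 gm hx; have mA := measurable_start_in HX I.
apply: integral_has_mean.
- exact: (measurable_state_draw k (fun s z => h s * g z)).
- by move=> w _; rewrite mulr_ge0.
- rewrite (integral_state_draw HX kernel_ge0 I k h0 g0) -(has_mean_integral mA hx).
  by apply: eq_integral => w _; rewrite gm.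
Qed.

Lemma has_mean_draw_le k (g : draw L -> R) (C : R) :
  (forall z, 0 <= g z) ->
  (forall s, \esum_(z in [set: draw L]) (g z * draw_kernel alg s.1 s.2 z)%:E <=
             C%:E)%E ->
  exists2 x, mean (fun w => g (frame_draw X k w)) x &
             x <= C * fine (P (start_in X I)).
Proof.
move=> g0 gC; pose m s := fine (\esum_(z in [set: draw L])
  (g z * draw_kernel alg s.1 s.2 z)%:E).
have s0 s : (0 <= \esum_(z in [set: draw L]) (g z * draw_kernel alg s.1 s.2 z)%:E)%E.
  by apply: esum_ge0 => z _; rewrite lee_fin mulr_ge0.
have mE s : (\esum_(z in [set: draw L]) (g z * draw_kernel alg s.1 s.2 z)%:E =
             (m s)%:E)%E.
  by rewrite /m fineK// ge0_fin_numE// (le_lt_trans (gC s))// ltry.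
have mC s : 0 <= m s <= C by rewrite -!lee_fin -mE s0 gC.
have mA := measurable_start_in HX I.
have [x mx] : exists x, mean (fun w => m (state X k w)) x.
  apply: (has_mean_dominated mA _ (has_mean_cst P mA C)).
    exact: (measurable_state_draw k (fun s _ => m s)).
  by move=> w _ /=; have /andP[m0 mC'] := mC (state X k w); rewrite ger0_norm.
exists x.
  have := @has_mean_draw k (cst 1) m g x (fun _ => ler01) g0 mE.
  have e (F : Om -> R) : (fun w => cst 1 (state X k w) * F w) = F.
    by apply/funext => w; rewrite mul1r.
  by rewrite !e; apply.
apply: (has_mean_le mA mx (has_mean_cst P mA C)) => w _.
by have /andP[] := mC (state X k w).
Qed.

End state_draw_mean.

(** * Drift *)

(** Squaring removes the positive part. In the expansion of (d + b - i)^2 the term -2 b i is dropped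
    and i^2 is replaced with m^2, where [m] bounds the service independently of the schedule; -2 d i
    moves to the left. *)
Lemma queue_step (R : realType) (d b i m : nat) : (i <= m)%N ->
  ((d + b - i)%N%:R ^+ 2 : R) + 2 * (d%:R * i%:R) <=
  d%:R ^+ 2 + b%:R ^+ 2 + m%:R ^+ 2 + 2 * (d%:R * b%:R).
Proof.
move=> im; have im' : (i%:R : R) <= m%:R by rewrite ler_nat.
have : ((d + b - i)%N%:R : R) ^+ 2 <= (d%:R + b%:R - i%:R) ^+ 2.
  have [idb|dbi] := leqP i (d + b); first by rewrite natrB// natrD.
  by rewrite (eqP (ltnW dbi : d + b - i == 0)%N) expr0n/= sqr_ge0.
move: (ler0n R d) (ler0n R b) (ler0n R i) im'.
move: (d + b - i)%N%:R d%:R b%:R i%:R m%:R => y d' b' i' m'.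
by rewrite !expr2; nra.
Qed.

Section frame_drift.
Context (R : realType) (L : finType) (N : network R L) (HN : network_ok N).
Context (v : static_point N) (Hv : static_feasible v).
Variables (eps : R) (eps0 : 0 < eps).

Let weight_eps_ge0 l : 0 <= eps^-1 * weight N l.
Proof. by rewrite mulr_ge0 ?invr_ge0 ?(ltW eps0) ?(weight_ge0 HN). Qed.

(* The mixture may have total mass below 1: the maximum is nonnegative. *)
Lemma sch_objective_max (a c d q : counts L) (s : schedule L (slots N)) :
  argmax (@feasible R L N a c) (@sch_objective R L N eps d q) s ->
  \sum_l ((eps^-1 * weight N l + (d l)%:R) * mui_cond v a c l +
          (q l)%:R * mue_cond v a c l) <= sch_objective eps d q s.
Proof.
move=> [_ smax].
have obj0 : 0 <= sch_objective eps d q s.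
  by apply: sumr_ge0 => l _; rewrite addr_ge0// mulr_ge0// addr_ge0.
have fin := @finite_feasible R L N a c.
set F := fset_set (@feasible R L N a c).
have memF r : r \in F -> feasible a c r by rewrite in_fset_set// inE.
(* The objective is linear in the packet totals with nonnegative coefficients, so its average under
   the mixture dominates its value at the conditional rates. *)
apply: (@le_trans _ _ (\sum_(r <- F) mix v a c r * sch_objective eps d q r)).
  have -> : \sum_(r <- F) mix v a c r * sch_objective eps d q r =
    \sum_l ((eps^-1 * weight N l + (d l)%:R) *
              (\sum_(r <- F) (inel_total r l)%:R * mix v a c r) +
            (q l)%:R * (\sum_(r <- F) (el_total r l)%:R * mix v a c r)).
    under eq_bigr do rewrite mulr_sumr.
    rewrite exchange_big/=; apply: eq_bigr => l _.
    rewrite !mulr_sumr -big_split/=; apply: eq_bigr => r _.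
    by ring.
  apply: ler_sum => l _; rewrite lerD//.
    rewrite ler_wpM2l ?addr_ge0//.
    by have := sf_mui_cond Hv l a c; rewrite fsbig_finite.
  rewrite ler_wpM2l//.
  by have := sf_mue_cond Hv l a c; rewrite fsbig_finite.
apply: (@le_trans _ _ (\sum_(r <- F) mix v a c r * sch_objective eps d q s)).
  rewrite big_seq [leRHS]big_seq; apply: ler_sum => r /memF rF.
  by rewrite ler_wpM2l ?smax//; exact: (sf_mix_ge0 Hv).
rewrite -mulr_suml ler_piMl//.
by have := sf_mix_le1 Hv a c; rewrite fsbig_finite.
Qed.

Context (Xmax sigmae : R) (alg : algorithm N).
Hypothesis Halg : algorithm_ok eps Xmax sigmae alg.
Context (d : measure_display) (Om : measurableType d) (P : probability Om R).
Context (X : process L Om) (HX : process_ok alg P X).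

Lemma inel_total_chosen k w l : (inel_total (chosen alg X k w) l <= arr X k w l)%N.
Proof.
have [[_ + _] _] :=
  sch_opt Halg (arr X k w) (chan X k w) (deficit X k w) (queue X k w).
exact.
Qed.

Lemma el_total_chosen k w l :
  (el_total (chosen alg X k w) l <= slots N * chan X k w l)%N.
Proof.
have [[_ _ cap] _] :=
  sch_opt Halg (arr X k w) (chan X k w) (deficit X k w) (queue X k w).
rewrite -[X in (_ <= X * _)%N]card_ord -sum_nat_const; apply: leq_sum => t _.
exact: leq_trans (leq_addl _ _) (cap l t).
Qed.

(** Valid for each outcome: [queue_step] for every counter, plus twice the optimality of the
    schedule, which trades the service terms for the conditional rates of (P). The splitting by
    [Num.max] makes all terms nonnegative, as domination and [has_mean_draw] require. *)
Lemma frame_drift k w :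
  \sum_l ((deficit X k.+1 w l)%:R ^+ 2 + (queue X k.+1 w l)%:R ^+ 2 +
    2 * ((eps^-1 * weight N l + (deficit X k w l)%:R) *
           Num.max (mui_cond v (arr X k w) (chan X k w) l) 0 +
         (queue X k w l)%:R *
           Num.max (mue_cond v (arr X k w) (chan X k w) l) 0)) <=
  \sum_l ((deficit X k w l)%:R ^+ 2 + (queue X k w l)%:R ^+ 2 +
    ((arr X k w l)%:R ^+ 2 + (toss X k w l)%:R ^+ 2 +
     (slots N * chan X k w l)%N%:R ^+ 2 + (adm X k w l)%:R ^+ 2) +
    2 * ((deficit X k w l)%:R * (toss X k w l)%:R +
         (queue X k w l)%:R * (adm X k w l)%:R +
         eps^-1 * weight N l * (inel_total (chosen alg X k w) l)%:R +
         (eps^-1 * weight N l + (deficit X k w l)%:R) *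
           Num.max (- mui_cond v (arr X k w) (chan X k w) l) 0 +
         (queue X k w l)%:R *
           Num.max (- mue_cond v (arr X k w) (chan X k w) l) 0)).
Proof.
have := sch_objective_max (sch_opt Halg (arr X k w) (chan X k w)
  (deficit X k w) (queue X k w)).
rewrite -subr_ge0 /sch_objective -sumrB => h.
rewrite -subr_ge0 -sumrB.
apply: le_trans (mulr_ge0 (ler0n R 2) h) _; rewrite mulr_sumr.
apply: ler_sum => l _.
have pn (x : R) : x = Num.max x 0 - Num.max (- x) 0.
  have [x0|x0] := leP x 0; first by rewrite max_l ?oppr_ge0//; ring.
  by rewrite max_r ?oppr_le0 ?(ltW x0)//; ring.
rewrite {1}[mui_cond v _ _ l]pn {1}[mue_cond v _ _ l]pn.
have := queue_step R (deficit X k w l) (toss X k w l) (inel_total_chosen k w l).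
have := queue_step R (queue X k w l) (adm X k w l) (el_total_chosen k w l).
rewrite (deficit_next HX) (queue_next HX) /chosen.
by lra.
Qed.

End frame_drift.

Lemma choice2 (T U : Type) (P Q : T -> U -> Prop) :
  (forall x, exists2 y, P x y & Q x y) ->
  exists f, forall x, P x (f x) /\ Q x (f x).
Proof.
move=> PQ; have [x|f hf] := @choice _ _ (fun x y => P x y /\ Q x y).
  by have [y] := PQ x; exists y.
by exists f.
Qed.

(** * Mean drift over an event of the initial state *)

Section mean_drift.
Context (R : realType) (L : finType) (N : network R L) (HN : network_ok N).
Context (v : static_point N) (Hv : static_feasible v).
Context (eps Xmax sigmae : R) (eps0 : 0 < eps).
Context (alg : algorithm N) (Halg : algorithm_ok eps Xmax sigmae alg).
Context (d : measure_display) (Om : measurableType d) (P : probability Om R).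
Context (X : process L Om) (HX : process_ok alg P X).
Variable I : set (counts L * counts L).

Hypothesis rate_Xmax : forall l, rate v l <= Xmax.
Variable ubound : L -> R.
Hypothesis utility_bound :
  forall l x, 0 <= x <= Xmax -> `|utility N l x| <= ubound l.
Variables arr2 chan2 : L -> R.
Hypothesis arr2E : forall l,
  (\esum_(a in [set: counts L]) ((a l)%:R ^+ 2 * arr_law N a)%:E = (arr2 l)%:E)%E.
Hypothesis chan2E : forall l,
  (\esum_(c in [set: counts L]) ((c l)%:R ^+ 2 * chan_law N c)%:E = (chan2 l)%:E)%E.

Let A := start_in X I.
Notation mean := (has_mean P A).
Let p := fine (P A).

Let mA : measurable A. Proof. exact: (measurable_start_in HX). Qed.
Let k0 := kernel_ge0 Halg.

(** The Lyapunov function V. *)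
Definition backlog k w : R :=
  \sum_l ((deficit X k w l)%:R ^+ 2 + (queue X k w l)%:R ^+ 2).

Definition reward k w : R :=
  \sum_l (utility N l (cc alg (deficit X k w) (queue X k w) l) +
          weight N l * (inel_total (chosen alg X k w) l)%:R).

(** The constant C of the drift. The moment [arr2 l] occurs twice: it bounds the square of the
    inelastic service and that of the retained arrivals. *)
Definition noise_bound : R :=
  \sum_l (arr2 l + arr2 l + (slots N)%:R ^+ 2 * chan2 l +
          (sigmae ^+ 2 + 2 * Xmax ^+ 2)).

Let mSZ := measurable_state_draw HX.

Let mean_draw_cst k (h : counts L * counts L -> R) (g : draw L -> R) x c :
  (forall s, 0 <= h s) -> (forall z, 0 <= g z) ->
  (forall s, \esum_(z in [set: draw L]) (g z * draw_kernel alg s.1 s.2 z)%:E =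
             c%:E)%E ->
  mean (fun w => h (state X k w)) x ->
  mean (fun w => h (state X k w) * g (frame_draw X k w)) (x * c).
Proof.
move=> h0 g0 gc hx; apply: (has_mean_draw HX k0 (m := cst c)) => //=.
rewrite mulrC; under eq_fun do rewrite mulrC.
exact: has_meanZ.
Qed.

Let natr_sqr_ge (n : nat) : (n%:R : R) <= n%:R ^+ 2.
Proof. by rewrite -natrX ler_nat -mulnn; case: n => // n; rewrite leq_pmulr. Qed.

Let cc_range k l w : 0 <= cc alg (deficit X k w) (queue X k w) l <= Xmax.
Proof. by have [] := cc_opt Halg (deficit X k w) (queue X k w) l. Qed.

Let mean_utility k l :
  exists y, mean (fun w => utility N l (cc alg (deficit X k w) (queue X k w) l)) y.
Proof.
apply: (has_mean_dominated mA _ (has_mean_cst P mA (ubound l))).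
  exact: (mSZ k (fun s _ => utility N l (cc alg s.1 s.2 l))).
by move=> w _; exact: utility_bound.
Qed.

Let mean_arr2 k l : exists2 y, mean (fun w => (arr X k w l)%:R ^+ 2) y & y <= arr2 l * p.
Proof.
apply: (@has_mean_draw_le _ _ _ _ _ _ _ _ HX k0 I k (fun z => (z.1.1.1 l)%:R ^+ 2)).
  by move=> z; rewrite sqr_ge0.
by move=> s; rewrite (kernel_second_moment_arr HN Halg _ _ (arr2E l)).
Qed.

Let mean_inel k l : exists y,
  mean (fun w => (inel_total (chosen alg X k w) l)%:R) y.
Proof.
have [y hy _] := mean_arr2 k l.
apply: (has_mean_dominated mA _ hy).
  exact: (mSZ k (fun s z =>
    (inel_total (sch alg z.1.1.1 z.1.1.2 s.1 s.2) l)%:R)).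
move=> w _; rewrite ger0_norm//; apply: le_trans (natr_sqr_ge _).
by rewrite ler_nat; exact: (inel_total_chosen Halg).
Qed.

Lemma mean_reward k : exists y, mean (reward k) y.
Proof.
have [U hU] := choice (mean_utility k); have [J hJ] := choice (mean_inel k).
exists (\sum_l (U l + weight N l * J l)).
exact: (has_mean_sum mA (index_enum L) (fun l =>
  has_meanD mA (hU l) (has_meanZ mA (weight N l) (hJ l)))).
Qed.

Section one_frame.
Variables (k : nat) (x : R).
Hypothesis hx : mean (backlog k) x.

(** A natural number is at most its square, so an integrable V makes all counters integrable. *)
Let backlog_ge l w : (deficit X k w l)%:R <= backlog k w /\
                     (queue X k w l)%:R <= backlog k w.
Proof.
rewrite /backlog (bigD1 l)//=.
have s0 : 0 <= \sum_(i | i != l)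
   (((deficit X k w i)%:R : R) ^+ 2 + (queue X k w i)%:R ^+ 2).
  by apply: sumr_ge0 => i _; rewrite addr_ge0// sqr_ge0.
have := natr_sqr_ge (deficit X k w l); have := natr_sqr_ge (queue X k w l).
have := sqr_ge0 ((deficit X k w l)%:R : R).
have := sqr_ge0 ((queue X k w l)%:R : R).
by split; lra.
Qed.

Let mean_deficit l : exists y, mean (fun w => (deficit X k w l)%:R) y.
Proof.
apply: (has_mean_dominated mA _ hx).
  exact: (mSZ k (fun s _ => (s.1 l)%:R)).
by move=> w _; rewrite ger0_norm//; exact: (backlog_ge l w).1.
Qed.

Let mean_queue l : exists y, mean (fun w => (queue X k w l)%:R) y.
Proof.
apply: (has_mean_dominated mA _ hx).
  exact: (mSZ k (fun s _ => (s.2 l)%:R)).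
by move=> w _; rewrite ger0_norm//; exact: (backlog_ge l w).2.
Qed.

Let mean_queue_cc l :
  exists y, mean (fun w => (queue X k w l)%:R * cc alg (deficit X k w) (queue X k w) l) y.
Proof.
have [y hy] := mean_queue l.
apply: (has_mean_dominated mA _ (has_meanZ mA Xmax hy)).
  exact: (mSZ k (fun s _ => (s.2 l)%:R * cc alg s.1 s.2 l)).
move=> w _; have /andP[c0 cX] := cc_range k l w.
by rewrite ger0_norm ?mulr_ge0// mulrC ler_wpM2r.
Qed.

Let mean_toss2 l : exists2 y, mean (fun w => (toss X k w l)%:R ^+ 2) y & y <= arr2 l * p.
Proof.
apply: (@has_mean_draw_le _ _ _ _ _ _ _ _ HX k0 I k (fun z => (z.1.2 l)%:R ^+ 2)).
  by move=> z; rewrite sqr_ge0.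
by move=> s; exact: (kernel_second_moment_toss HN Halg _ _ (arr2E l)).
Qed.

Let mean_chan2 l : exists2 y,
  mean (fun w => (slots N * chan X k w l)%N%:R ^+ 2) y &
  y <= (slots N)%:R ^+ 2 * chan2 l * p.
Proof.
apply: (@has_mean_draw_le _ _ _ _ _ _ _ _ HX k0 I k
  (fun z => (slots N * z.1.1.2 l)%N%:R ^+ 2)).
  by move=> z; rewrite sqr_ge0.
move=> s; rewrite EFinM -(kernel_second_moment_chan HN Halg s.1 s.2 (chan2E l)).
rewrite -ge0_esumZl ?sqr_ge0//; last first.
  by move=> z; rewrite lee_fin mulr_ge0// sqr_ge0.
apply: le_esum => z _.
by rewrite -EFinM lee_fin natrM exprMn -mulrA.
Qed.

Let mean_adm2 l : exists2 y, mean (fun w => (adm X k w l)%:R ^+ 2) y &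
  y <= (sigmae ^+ 2 + 2 * Xmax ^+ 2) * p.
Proof.
apply: (@has_mean_draw_le _ _ _ _ _ _ _ _ HX k0 I k (fun z => (z.2 l)%:R ^+ 2)).
  by move=> z; rewrite sqr_ge0.
by move=> s; exact: (kernel_second_moment_adm Halg).
Qed.

(** [yz] consists of the means of the two parts of a conditional rate over a draw. They are the same
    in all states, since arrivals and channel do not depend on the state. *)
Let is_split (m : counts L -> counts L -> L -> R) (mu : L -> R) l (yz : R * R) :=
  [/\ yz.1 - yz.2 = mu l,
    (forall s : counts L * counts L, \esum_(z in [set: draw L])
      (Num.max (m z.1.1.1 z.1.1.2 l) 0 * draw_kernel alg s.1 s.2 z)%:E = yz.1%:E)%E &
    (forall s : counts L * counts L, \esum_(z in [set: draw L])
      (Num.max (- m z.1.1.1 z.1.1.2 l) 0 * draw_kernel alg s.1 s.2 z)%:E = yz.2%:E)%E].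

Let static_split m mu l :
  sums_to (fun ac => m ac.1 ac.2 l * chan_law N ac.2 * arr_law N ac.1) (mu l) ->
  exists yz, is_split m mu l yz.
Proof.
under eq_fun do rewrite -mulrA.
move=> /sums_to_parts[].
  move=> ac; apply: mulr_ge0; [exact: (law_ge0 (chan_lawP HN))|].
  exact: (law_ge0 (arr_lawP HN)).
move=> y [z [yz yE zE]]; exists (y, z); split => // s.
  rewrite -yE (kernel_sum_env HN Halg _ _
    (f := fun ac => Num.max (m ac.1 ac.2 l) 0))// => ac.
  by rewrite le_max lexx orbT.
rewrite -zE (kernel_sum_env HN Halg _ _
  (f := fun ac => Num.max (- m ac.1 ac.2 l) 0))// => ac.
by rewrite le_max lexx orbT.
Qed.

(** The mean of V(k+1) is asserted to exist, not assumed, which is what allows the estimate to be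
    iterated. *)
Lemma mean_drift : exists x' y, [/\ mean (backlog k.+1) x', mean (reward k) y &
  x' <= x + noise_bound * p + 2 * eps^-1 * (y - static_objective v * p)].
Proof.
have [D hD] := choice mean_deficit.
have [Q hQ] := choice mean_queue.
have [Y hY] := choice mean_queue_cc.
have [U hU] := choice (mean_utility k).
have [J hJ] := choice (mean_inel k).
have [a2 ha2] := choice2 (mean_arr2 k).
have [b2 hb2] := choice2 mean_toss2.
have [c2 hc2] := choice2 mean_chan2.
have [e2 he2] := choice2 mean_adm2.
have [iy hi] := choice (fun l => static_split (sf_mui Hv l)).
have [ey he] := choice (fun l => static_split (sf_mue Hv l)).
pose ew l := eps^-1 * weight N l.
have ew0 l : 0 <= ew l.
  by rewrite mulr_ge0 ?invr_ge0 ?(ltW eps0) ?(weight_ge0 HN).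
have max0 (y : R) : 0 <= Num.max y 0 by rewrite le_max lexx orbT.
have hDw l : mean (fun w => ew l + (deficit X k w l)%:R) (ew l * p + D l).
  exact: (has_meanD mA (has_mean_cst P mA (ew l)) (hD l)).
have hDb l : mean (fun w => (deficit X k w l)%:R * (toss X k w l)%:R)
    (D l * (arr_mean N l * (1 - loss N l))).
  apply: (mean_draw_cst (h := fun s => (s.1 l)%:R) (g := fun z => (z.1.2 l)%:R)) => //.
  by move=> s; exact: (kernel_mean_toss HN Halg).
(* Unlike the other products this mean does not factor, because the admission rate depends on the
   queues; it is the mean [Y l] of queue times controlled rate. *)
have hQe l : mean (fun w => (queue X k w l)%:R * (adm X k w l)%:R) (Y l).
  apply: (has_mean_draw HX k0 (h := fun s => (s.2 l)%:R)
    (m := fun s => cc alg s.1 s.2 l) (g := fun z => (z.2 l)%:R)) => // s.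
  apply: sums_to_ge0 (kernel_adm_mean Halg s.1 s.2 l) => z.
  by rewrite mulr_ge0.
have hPi l : mean (fun w => (ew l + (deficit X k w l)%:R) *
    Num.max (mui_cond v (arr X k w) (chan X k w) l) 0) ((ew l * p + D l) * (iy l).1).
  have [_ h _] := hi l.
  apply: (mean_draw_cst (h := fun s => ew l + (s.1 l)%:R)
    (g := fun z => Num.max (mui_cond v z.1.1.1 z.1.1.2 l) 0)) => //.
  by move=> s; rewrite addr_ge0.
have hNi l : mean (fun w => (ew l + (deficit X k w l)%:R) *
    Num.max (- mui_cond v (arr X k w) (chan X k w) l) 0) ((ew l * p + D l) * (iy l).2).
  have [_ _ h] := hi l.
  apply: (mean_draw_cst (h := fun s => ew l + (s.1 l)%:R)
    (g := fun z => Num.max (- mui_cond v z.1.1.1 z.1.1.2 l) 0)) => //.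
  by move=> s; rewrite addr_ge0.
have hPe l : mean (fun w => (queue X k w l)%:R *
    Num.max (mue_cond v (arr X k w) (chan X k w) l) 0) (Q l * (ey l).1).
  have [_ h _] := he l.
  by apply: (mean_draw_cst (h := fun s => (s.2 l)%:R)
    (g := fun z => Num.max (mue_cond v z.1.1.1 z.1.1.2 l) 0)).
have hNe l : mean (fun w => (queue X k w l)%:R *
    Num.max (- mue_cond v (arr X k w) (chan X k w) l) 0) (Q l * (ey l).2).
  have [_ _ h] := he l.
  by apply: (mean_draw_cst (h := fun s => (s.2 l)%:R)
    (g := fun z => Num.max (- mue_cond v z.1.1.1 z.1.1.2 l) 0)).
have hLHS := has_mean_sum mA (index_enum L)
  (fun l => has_meanZ mA 2 (has_meanD mA (hPi l) (hPe l))).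
have hRHS := has_meanD mA hx (has_mean_sum mA (index_enum L) (fun l =>
  has_meanD mA
    (has_meanD mA (has_meanD mA (has_meanD mA (ha2 l).1 (hb2 l).1) (hc2 l).1) (he2 l).1)
    (has_meanZ mA 2 (has_meanD mA (has_meanD mA (has_meanD mA (has_meanD mA
      (hDb l) (hQe l)) (has_meanZ mA (ew l) (hJ l))) (hNi l)) (hNe l))))).
(* The terms added to V(k+1) on the left of [frame_drift] are nonnegative, so its right-hand side
   dominates V(k+1). *)
have [x' hx'] : exists x', mean (backlog k.+1) x'.
  apply: (has_mean_dominated mA _ hRHS).
    exact: (mSZ k.+1 (fun s _ => \sum_l ((s.1 l)%:R ^+ 2 + (s.2 l)%:R ^+ 2))).
  move=> w _; rewrite ger0_norm; last first.
    by apply: sumr_ge0 => l _; rewrite addr_ge0// sqr_ge0.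
  rewrite -big_split/=.
  apply: le_trans (le_trans _ (frame_drift HN Hv eps0 Halg HX k w)) _; last first.
    by apply: ler_sum => l _; rewrite !addrA.
  apply: ler_sum => l _; rewrite lerDl mulr_ge0// addr_ge0// mulr_ge0//.
  by rewrite addr_ge0//; exact: ew0.
exists x', (\sum_l (U l + weight N l * J l)); split => //.
  exact: (has_mean_sum mA (index_enum L) (fun l =>
    has_meanD mA (hU l) (has_meanZ mA (weight N l) (hJ l)))).
(* The static rate is admissible in (CC), being at most [Xmax]; comparing it with the optimum brings
   in the utility gap. *)
have rate_opt l : Y l <= rate v l * Q l + eps^-1 * (U l - utility N l (rate v l) * p).
  have -> : rate v l * Q l + eps^-1 * (U l - utility N l (rate v l) * p) =
    rate v l * Q l + eps^-1 * U l + (- (eps^-1 * utility N l (rate v l))) * p.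
    by ring.
  apply: (has_mean_le mA (hY l) (has_meanD mA (has_meanD mA
    (has_meanZ mA (rate v l) (hQ l)) (has_meanZ mA eps^-1 (hU l)))
    (has_mean_cst P mA (- (eps^-1 * utility N l (rate v l)))))) => w _.
  have [_ /(_ (rate v l))] := cc_opt Halg (deficit X k w) (queue X k w) l.
  rewrite /cc_objective /= => h.
  have /andP[r0 _] := sf_rate Hv l.
  have : 0 <= rate v l <= Xmax by rewrite r0 rate_Xmax.
  by move=> /h; rewrite /cst; lra.
have drift := has_mean_le mA (has_meanD mA hx' hLHS) hRHS _.
have {drift} : x' + \sum_l 2 * ((ew l * p + D l) * (iy l).1 + Q l * (ey l).1) <=
  x + \sum_l (a2 l + b2 l + c2 l + e2 l +
    2 * (D l * (arr_mean N l * (1 - loss N l)) + Y l + ew l * J l +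
      (ew l * p + D l) * (iy l).2 + Q l * (ey l).2)).
  apply: drift => w _; rewrite /backlog -!big_split/=.
  apply: le_trans (frame_drift HN Hv eps0 Halg HX k w) _.
  by apply: ler_sum => l _; rewrite !addrA.
rewrite -lerBrDr => drift; apply: le_trans drift _.
rewrite -!addrA lerD2l -sumrB /noise_bound /static_objective.
rewrite !mulr_suml -sumrB mulr_sumr -big_split/=; apply: ler_sum => l _.
have [iyE _ _] := hi l; have [eyE _ _] := he l.
have ge0 F y : mean F y -> (forall w, 0 <= F w) -> 0 <= y.
  move=> hF F0; rewrite -[0](mul0r p).
  by apply: (has_mean_le mA (has_mean_cst P mA 0) hF) => w _; exact: F0.
have D0 : 0 <= D l by exact: ge0 (hD l) _.
have Q0 : 0 <= Q l by exact: ge0 (hQ l) _.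
(* What the cross terms leave over is minus twice the sum of [Dmu] and [Qmu], whose signs come from
   the loss and rate constraints of (P). *)
have Dmu : 0 <= D l * (mui v l - arr_mean N l * (1 - loss N l)).
  by rewrite mulr_ge0// subr_ge0 (sf_loss Hv).
have Qmu : 0 <= Q l * (mue v l - rate v l).
  by rewrite mulr_ge0// subr_ge0; have /andP[] := sf_rate Hv l.
have := rate_opt l; have := (ha2 l).2; have := (hb2 l).2.
have := (hc2 l).2; have := (he2 l).2.
rewrite /ew; move: Dmu Qmu; rewrite -iyE -eyE.
by lra.
Qed.


End one_frame.

Lemma mean_drift_sum K x : mean (backlog 0) x ->
  exists x' y, [/\ mean (backlog K) x',
    mean (fun w => \sum_(0 <= k < K) reward k w) y &
    x' <= x + noise_bound * p *+ K + 2 * eps^-1 * (y - static_objective v * p *+ K)].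
Proof.
move=> hx; elim: K => [|K [x' [y [hx' hy xy]]]].
  exists x, 0; split => //; last by rewrite !mulr0n subrr mulr0 !addr0.
  under eq_fun do rewrite big_nil.
  by have := has_mean_cst P mA 0; rewrite mul0r.
have [x'' [z [hx'' hz xz]]] := mean_drift hx'.
exists x'', (y + z); split => //.
  by under eq_fun do rewrite big_nat_recr//=; exact: has_meanD.
by rewrite !mulrSr; lra.
Qed.

Lemma mean_regret K x : mean (backlog 0) x ->
  exists2 y, mean (fun w => \sum_(0 <= k < K) reward k w) y &
    static_objective v * p *+ K - y <= eps / 2 * (x + noise_bound * p *+ K).
Proof.
(* The mean of V(K) is nonnegative and is discarded; multiplication by [eps / 2] then isolates the
   regret. *)
move=> /(mean_drift_sum K)[x' [y [hx' hy xy]]]; exists y => //.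
have x'0 : 0 <= x'.
  rewrite -[0](mul0r p); apply: (has_mean_le mA (has_mean_cst P mA 0) hx') => w _.
  by apply: sumr_ge0 => l _; rewrite addr_ge0// sqr_ge0.
have := mulr_ge0 (ltW eps0) (le_trans x'0 xy).
have -> : eps * (x + noise_bound * p *+ K +
    2 * eps^-1 * (y - static_objective v * p *+ K)) =
  eps * (x + noise_bound * p *+ K) + 2 * (eps / eps) * (y - static_objective v * p *+ K).
  by ring.
by rewrite divff ?gt_eqF//; lra.
Qed.

End mean_drift.

(** * Bounds uniform in the initial state *)

(** Compactness is of no use here, as a concave function on the closed half-line may jump at 0. The
    chord from 0 to X bounds f from below; since X/2 is the midpoint of x and X - x, f(x) <= 2
    f(X/2) - f(X - x), and the lower bound at X - x bounds f from above. *)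
Lemma concave_bounded (R : realType) (f : R -> R) (X : R) :
  concave_on_nonneg f ->
  exists M : R, forall x : R, 0 <= x <= X -> `|f x| <= M.
Proof.
move=> cf; have [X0|X0] := leP 0 X; last first.
  by exists 0 => x /andP[x0 xX]; have := le_lt_trans (le_trans x0 xX) X0; rewrite ltxx.
have conv (t : {i01 R}) x y : 0 <= x -> 0 <= y ->
    t%:num * f x + (1 - t%:num) * f y <= f (t%:num * x + (1 - t%:num) * y).
  move=> x0 y0; have := cf t x y (mem_set x0) (mem_set y0).
  by rewrite convRE !mulrN -opprD lerN2.
have h0 : 0 <= 2^-1 :> R by rewrite invr_ge0.
have h1 : 2^-1 <= 1 :> R by rewrite invf_le1 ?ler1n.
have lower x : 0 <= x <= X -> - (`|f 0| + `|f X|) <= f x.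
  move=> /andP[x0 xX].
  have [X00|Xn0] := eqVneq X 0.
    have -> : x = 0 by apply/eqP; rewrite eq_le x0 -X00 xX.
    by have := ler_norm (- f 0); rewrite normrN; have := normr_ge0 (f X); lra.
  have Xp : 0 < X by rewrite lt_def Xn0.
  have t0 : 0 <= x / X by rewrite divr_ge0.
  have t1 : x / X <= 1 by rewrite ler_pdivrMr// mul1r.
  have := conv (Itv01 t0 t1) X 0 X0 (lexx _) => /=.
  rewrite mulr0 addr0 divfK// => le_fx; apply: le_trans le_fx.
  have := ler_norm (- f 0); have := ler_norm (- f X); rewrite !normrN.
  have := normr_ge0 (f 0); have := normr_ge0 (f X).
  move: t0 t1; move: (x / X) `|f 0| `|f X| (f 0) (f X) => t A B a b.
  by nra.
exists (2 * `|f (X / 2)| + `|f 0| + `|f X|) => x /[dup] xX /andP[x0 xX'].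
have lx := lower _ xX.
have ly : - (`|f 0| + `|f X|) <= f (X - x) by apply: lower; lra.
have := conv (Itv01 h0 h1) x (X - x) x0 (ltac:(lra) : 0 <= X - x) => /=.
rewrite (_ : 2^-1 * x + _ = X / 2); last by field.
have := ler_norm (f (X / 2)); have := normr_ge0 (f (X / 2)).
move: ly lx; move: `|f 0| `|f X| => A B.
by rewrite ler_norml; lra.
Qed.

Lemma limn_esup_le (R : realType) (u : (\bar R)^nat) (l : \bar R) n0 :
  (forall n, (n0 <= n)%N -> (u n <= l)%E) -> (limn_esup u <= l)%E.
Proof.
move=> ul; rewrite /limn_esup /limf_esup.
apply: (@le_trans _ _ (ereal_sup (u @` [set n | (n0 <= n)%N]))).
  apply: ereal_inf_lbound; exists [set n | (n0 <= n)%N] => //.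
  by exists n0.
by apply: ge_ereal_sup => _ [n /= nn0 <-]; exact: ul.
Qed.

Lemma expectation_split (d : measure_display) (Om : measurableType d)
    (R : realType) (P : probability Om R) (A : set Om) (F : Om -> R) (x y : R) :
  measurable A -> measurable_fun setT F ->
  has_mean P A F x -> has_mean P (~` A) F y -> ('E_P[F] = (x + y)%:E)%E.
Proof.
move=> mA mF hx hy; have mA' := measurableC mA.
rewrite unlock -(setUv A) integral_setU//.
- by rewrite (has_mean_integral mA hx) (has_mean_integral mA' hy).
- by rewrite setUv; exact/measurable_EFinP.
- by apply/disj_setPS; rewrite setICr.
Qed.

Lemma fine_probability_setC (d : measure_display) (Om : measurableType d)
    (R : realType) (P : probability Om R) (A : set Om) : measurable A ->
  fine (P (~` A)) = 1 - fine (P A).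
Proof.
move=> mA; rewrite probability_setC// fineB ?fin_num_measure//.
Qed.

Lemma fine_probability_le1 (d : measure_display) (Om : measurableType d)
    (R : realType) (P : probability Om R) (A : set Om) : measurable A ->
  0 <= fine (P A) <= 1.
Proof.
move=> mA; rewrite fine_ge0//= -lee_fin fineK ?fin_num_measure//.
exact: probability_le1.
Qed.

(** The initial backlog is finite at every outcome, so these events increase to the whole space and
    continuity from below applies, whatever the moments of the initial state. *)
Lemma backlog_start_small (R : realType) (L : finType) (N : network R L)
    (alg : algorithm N) (d : measure_display) (Om : measurableType d)
    (P : probability Om R) (X : process L Om) (delta : R) :
  process_ok alg P X -> 0 < delta ->
  exists M : nat, 1 - delta <= fine (P [set w | backlog R X 0 w <= M%:R]).
Proof.
move=> HX delta0; pose A M := [set w | backlog R X 0 w <= M%:R].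
have mA M : measurable (A M).
  exact: (measurable_start_in HX [set s : counts L * counts L |
    \sum_l (((s.1 l)%:R : R) ^+ 2 + (s.2 l)%:R ^+ 2) <= M%:R]).
have AT : \bigcup_M A M = setT.
  apply/seteqP; split => // w _.
  exists (Num.truncn (backlog R X 0 w)).+1 => //.
  by rewrite /A /= ltW// truncnS_gt.
have ndA : nondecreasing_seq A.
  move=> m n mn; apply/subsetPset => w /le_trans; apply.
  by rewrite ler_nat.
have mT : measurable (\bigcup_M A M) by rewrite AT.
have cvgA : P \o A @ \oo --> (1%E : \bar R).
  by rewrite -(probability_setT P) -AT; exact: nondecreasing_cvg_mu.
apply: contrapT => /forallNP small.
have : (limn (P \o A) <= (1 - delta)%:E)%E.
  apply: lime_le; first by apply/cvg_ex; exists 1%E.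
  apply: nearW => n /=; rewrite -[P _]fineK ?fin_num_measure// lee_fin.
  by have /negP := small n; rewrite -ltNge => /ltW.
by rewrite (cvg_lim _ cvgA)// lee_fin; lra.
Qed.

(** * The bound on the limit superior *)

Unset Implicit Arguments.
Set Strict Implicit.
Set Printing Implicit Defensive.

Theorem theorem1 (R : realType) (L : finType) (N : network R L)
    (star : static_point N) (Xmax sigmae : R)
    (HN : network_ok N)
    (Hstar : static_solution star)
    (Hmui : forall l, arr_mean N l * (1 - loss N l) < mui star l)
    (Hmue : forall l, rate star l < mue star l)
    (HXmax : forall l, rate star l < Xmax) :
  exists B : R, 0 < B /\
    forall (eps : R) (alg : algorithm N) (d : measure_display)
      (Om : measurableType d) (P : probability Om R) (X : process L Om),
      0 < eps ->
      algorithm_ok eps Xmax sigmae alg ->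
      process_ok alg P X ->
      (limn_esup (fun K : nat =>
         'E_P[fun o =>
           (\sum_(l : L)
              (utility N l (rate star l) + weight N l * mui star l)
            - \sum_(l : L) (K%:R^-1 *
                \sum_(0 <= k < K)
                  utility N l (cc alg (deficit X k o) (queue X k o) l))
            - \sum_(l : L) (K%:R^-1 *
                \sum_(0 <= k < K)
                  weight N l * (inel_total (chosen alg X k o) l)%:R))%R])
       <= (B * eps)%:E)%E.
Proof.
have [Hv _] := Hstar.
have rate_Xmax l : rate star l <= Xmax by exact: ltW.
have [arr2 arr2E] := choice (fun l : L => law_second_moment l (arr_lawP HN)).
have [chan2 chan2E] := choice (fun l : L => law_second_moment l (chan_lawP HN)).
have [ub ubE] := choice (fun l : L => concave_bounded Xmax (utility_concave HN l)).
pose nb := noise_bound N Xmax sigmae arr2 chan2.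
have nb0 : 0 <= nb.
  have arr20 l : 0 <= arr2 l.
    rewrite -lee_fin -arr2E; apply: esum_ge0 => a _; rewrite lee_fin.
    by rewrite mulr_ge0 ?sqr_ge0// (law_ge0 (arr_lawP HN)).
  have chan20 l : 0 <= chan2 l.
    rewrite -lee_fin -chan2E; apply: esum_ge0 => a _; rewrite lee_fin.
    by rewrite mulr_ge0 ?sqr_ge0// (law_ge0 (chan_lawP HN)).
  apply: sumr_ge0 => l _.
  rewrite addr_ge0//; last by rewrite addr_ge0 ?sqr_ge0// mulr_ge0 ?sqr_ge0.
  by rewrite addr_ge0//; [exact: addr_ge0|rewrite mulr_ge0 ?sqr_ge0].
(* [nb / 2] is the drift constant; the 1 is shared equally by the initial backlog and by the event
   where it exceeds M. *)
exists (nb / 2 + 1); split; first by lra.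
move=> eps alg d Om P X eps0 Halg HX.
pose obj := static_objective star.
have ub0 : 0 <= \sum_l ub l.
  apply: sumr_ge0 => l _; apply: le_trans (normr_ge0 (utility N l (rate star l))) _.
  by apply: ubE; rewrite rate_Xmax andbT; have /andP[] := sf_rate Hv l.
(* [G] bounds the average regret at every outcome. [delta] is chosen such that
   [G * delta <= eps / 2]; the +1 in it avoids a division by zero. *)
pose G := `|obj| + \sum_l ub l.
have G0 : 0 <= G by rewrite addr_ge0.
pose delta := eps / (2 * (G + 1)).
have delta0 : 0 < delta by rewrite divr_gt0// mulr_gt0//; lra.
have [M hM] := backlog_start_small HX delta0.
pose I : set (counts L * counts L) := [set s : counts L * counts L |
  \sum_l (((s.1 l)%:R : R) ^+ 2 + (s.2 l)%:R ^+ 2) <= M%:R].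
pose S K w := \sum_(0 <= k < K) reward alg X k w.
pose F K w := obj + (- K%:R^-1 * S K w).
have FE K : (fun w => \sum_(l : L) (utility N l (rate star l) + weight N l * mui star l)
    - \sum_(l : L) (K%:R^-1 *
        \sum_(0 <= k < K) utility N l (cc alg (deficit X k w) (queue X k w) l))
    - \sum_(l : L) (K%:R^-1 *
        \sum_(0 <= k < K) weight N l * (inel_total (chosen alg X k w) l)%:R)) = F K.
  apply/funext => w; rewrite /F /S /reward exchange_big/= mulNr mulr_sumr.
  rewrite -addrA -opprD -big_split/=; congr (_ - _).
  by apply: eq_bigr => l _; rewrite big_split/= mulrDr.
(* A one-sided bound suffices: the regret is bounded from above because the utilities are bounded
   and the inelastic part of the reward is nonnegative. *)
have S_ge K w : - (K%:R * \sum_l ub l) <= S K w.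
  rewrite -mulrN mulr_natl -[in leLHS](subn0 K) -sumr_const_nat.
  apply: ler_sum => k _; rewrite /reward -sumrN; apply: ler_sum => l _.
  have [/(ubE l) ubk _] := cc_opt Halg (deficit X k w) (queue X k w) l.
  move: ubk; rewrite ler_norml => /andP[ubk _].
  by apply: le_trans ubk _; rewrite lerDl mulr_ge0// (weight_ge0 HN).
have meanS J K : exists y, has_mean P (start_in X J) (S K) y.
  have [y hy] := choice (mean_reward HN Halg HX J ubE arr2E).
  exists (\sum_(0 <= k < K) y k).
  exact: (has_mean_sum (measurable_start_in HX J) _ hy).
have meanF J K y : has_mean P (start_in X J) (S K) y ->
    has_mean P (start_in X J) (F K) (obj * fine (P (start_in X J)) + - K%:R^-1 * y).
  move=> hy; have mJ := measurable_start_in HX J.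
  exact: (has_meanD mJ (has_mean_cst P mJ obj) (has_meanZ mJ _ hy)).
have mF K : measurable_fun setT (F K).
  have [y /meanF[/integrableP[+ _] _]] := meanS setT K.
  by move=> /measurable_EFinP.
have mI := measurable_start_in HX I.
have [x0 hx0] : exists x, has_mean P (start_in X I) (backlog R X 0) x.
  apply: (has_mean_dominated mI _ (has_mean_cst P mI M%:R)).
    exact: (measurable_state_draw HX 0
      (fun s _ => \sum_l ((s.1 l)%:R ^+ 2 + (s.2 l)%:R ^+ 2))).
  move=> w wI; rewrite ger0_norm//.
  by apply: sumr_ge0 => l _; rewrite addr_ge0// sqr_ge0.
have /andP[p0 p1] := fine_probability_le1 P mI.
set p := fine _ in p0 p1.
have x0M : x0 <= M%:R.
  apply: (@le_trans _ _ (M%:R * p)); last by rewrite ler_piMr.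
  exact: (has_mean_le mI hx0 (has_mean_cst P mI M%:R)).
(* For K > M the contribution M / K of the initial backlog is at most 1, and K is invertible. *)
apply: (@limn_esup_le _ _ _ M.+1) => K MK.
have K0 : (0 < K)%N by exact: leq_ltn_trans MK.
have Kr0 : 0 < K%:R :> R by rewrite ltr0n.
rewrite FE.
have [y hy regret] := mean_regret HN Hv eps0 Halg HX rate_Xmax ubE arr2E chan2E K hx0.
(* The complement is again an event of the initial state, so the means there exist as well, although
   V(0) is unbounded on it. *)
have [y' hy'] := meanS (~` I) K.
rewrite (expectation_split mI (mF K) (meanF _ _ _ hy) (meanF _ _ _ hy')) lee_fin.
have tail : obj * fine (P (start_in X (~` I))) + - K%:R^-1 * y' <= eps / 2.
  have mI' : measurable (start_in X (~` I)) by exact: (measurable_start_in HX).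
  apply: (@le_trans _ _ (G * fine (P (start_in X (~` I))))).
    apply: (has_mean_le mI' (meanF _ _ _ hy') (has_mean_cst P mI' G)) => w _.
    rewrite /F /G lerD ?ler_norm// mulNr lerNl.
    by rewrite ler_pdivlMl// mulrN.
  rewrite (fine_probability_setC P mI) -/p.
  apply: (@le_trans _ _ (G * delta)); first
    by rewrite ler_wpM2l//; move: hM; rewrite -/p; lra.
  rewrite /delta mulrCA ler_wpM2l ?(ltW eps0)//.
  rewrite ler_pdivrMr; last by lra.
  by rewrite mulrA mulVf ?pnatr_eq0// mul1r; lra.
have body : obj * p + - K%:R^-1 * y <= eps / 2 * (1 + nb).
  have -> : obj * p + - K%:R^-1 * y = K%:R^-1 * (obj * p *+ K - y).
    by rewrite mulrBr -(mulr_natl (obj * p) K) mulKf ?gt_eqF// mulNr.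
  rewrite ler_pdivrMl//; apply: le_trans regret _.
  rewrite -mulrCA ler_wpM2l ?divr_ge0 ?(ltW eps0)//.
  rewrite -(mulr_natl (nb * p) K) mulrDr mulr1 lerD//.
    by apply: le_trans x0M _; rewrite ler_nat ltnW.
  by rewrite ler_wpM2l// ler_piMr.
apply: le_trans (lerD body tail) _.
by rewrite (_ : eps / 2 * (1 + nb) + eps / 2 = (nb / 2 + 1) * eps) ?lexx//; field.
Qed.
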